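(* Let $D$ be a finitely connected domain with $\infty\in D$ and $0\notin D$, and let $n$ be the number of connected components of $\hat{\mathbb{C}}\setminus D$. From a name of $D$, a name of $\partial D$, and $n$, one can uniformly compute: - a labeling $D_{0,1},\dots,D_{0,n}$ of the connected components of $\hat{\mathbb{C}}\setminus D$; - names of the open sets $\hat{\mathbb{C}}\setminus D_{0,1},\dots,\hat{\mathbb{C}}\setminus D_{0,n}$; - names of the closed sets $\partial D_{0,1},\dots,\partial D_{0,n}$.
   Context: Computability is in the sense of Type-Two Effectivity. $\hat{\mathbb{C}}=\mathbb{C}\cup\{\infty\}$, and $D_r(z)$ is the open disk of radius $r$ centered at $z$. The basic open sets are the open rectangles whose vertices have rational coordinates, together with the sets $\hat{\mathbb{C}}\setminus\overline{D_r(0)}$ with $r$ rational. Names: - A name of a point $z\in\hat{\mathbb{C}}$ is a list of all basic open sets containing $z$. - A name of an open set $U$ is a list of all basic open sets whose closures lie in $U$. - A name of a closed set $C$ is a list of all basic open sets meeting $C$. - ''Uniformly computable'' means a single Turing machine with one-way output tape, given names of the data, writes names of the outputs. A domain is an open connected subset of $\hat{\mathbb{C}}$. It is finitely connected if its complement has finitely many connected components. *)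

(* Defs.v *)
From mathcomp Require Import all_boot all_algebra.
From mathcomp Require Import reals.

Set Implicit Arguments.
Unset Strict Implicit.
Unset Printing Implicit Defensive.
Import GRing.Theory Num.Theory.
Local Open Scope ring_scope.

Inductive rf : Type :=
| RZero : rf
| RSucc : rf
| RProj : nat -> rf
| RComp : rf -> seq rf -> rf
| RPrec : rf -> rf -> rf
| RMu   : rf -> rf.

Inductive rf_eval : rf -> seq nat -> nat -> Prop :=
| ev_zero v : rf_eval RZero v 0
| ev_succ x v : rf_eval RSucc (x :: v) x.+1
| ev_proj i v : (i < size v)%N -> rf_eval (RProj i) v (nth 0%N v i)
| ev_comp f gs v ys y :
    rf_evals gs v ys -> rf_eval f ys y -> rf_eval (RComp f gs) v y
| ev_prec0 f g v y : rf_eval f v y -> rf_eval (RPrec f g) (0%N :: v) y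
| ev_precS f g k v r y :
    rf_eval (RPrec f g) (k :: v) r -> rf_eval g (k :: r :: v) y ->
    rf_eval (RPrec f g) (k.+1 :: v) y
| ev_mu f v k :
    rf_eval f (k :: v) 0 ->
    (forall m, (m < k)%N -> exists r, rf_eval f (m :: v) r.+1) ->
    rf_eval (RMu f) v k
with rf_evals : seq rf -> seq nat -> seq nat -> Prop :=
| evs_nil v : rf_evals [::] v [::]
| evs_cons g gs v y ys :
    rf_eval g v y -> rf_evals gs v ys -> rf_evals (g :: gs) v (y :: ys).

Definition cpair (x y : nat) : nat := (((x + y) * (x + y).+1)./2 + y)%N.

Fixpoint code_word (w : seq nat) : nat :=
  match w with
  | [::] => 0%N
  | x :: w' => (cpair x (code_word w')).+1
  end.

Definition prefix (p : nat -> nat) (m : nat) : seq nat := mkseq p m.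

(* A (total) recursive function M of four arguments realises a TTE machine
   with inputs (n, p1, p2) (n : nat, p1 p2 : Baire-space names) and output
   q : nat -> nat: on input k, n and the codes of the first m symbols of p1 and
   p2, M answers 0 ("no output yet") or v.+1 ("output symbol number k is v").
   This is the standard characterisation of TTE-computable (one-way output
   tape) functionals via monotone computable word functions. *)
Definition rf_total4 (M : rf) : Prop :=
  forall a b c d : nat, exists y, rf_eval M [:: a; b; c; d] y.

Definition machine_computes (M : rf) (n : nat) (p1 p2 q : nat -> nat) : Prop :=
  (forall k, exists m,
      rf_eval M [:: k; n; code_word (prefix p1 m); code_word (prefix p2 m)]
              (q k).+1) /\
  (forall k m v,
      rf_eval M [:: k; n; code_word (prefix p1 m); code_word (prefix p2 m)] v.+1 ->
      v = q k).

(* None is the point at infinity; Some (x, y) is x + i y. *)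
Definition Chat (R : realType) := option (R * R).

Definition cset (R : realType) := Chat R -> Prop.

(* basic open set codes: open rational rectangles (a,b) x (c,d), and
   exteriors  Chat \ closed disk of radius r centred at 0  *)
Definition basic := ((rat * rat) * (rat * rat) + rat)%type.

Definition basic_valid (b : basic) : Prop :=
  match b with
  | inl ((a, b'), (c, d)) => a < b' /\ c < d
  | inr r => 0 < r
  end.

Definition in_basic (R : realType) (b : basic) (z : Chat R) : Prop :=
  match b, z with
  | inl ((a, b'), (c, d)), Some (x, y) =>
      ratr a < x /\ x < ratr b' /\ ratr c < y /\ y < ratr d
  | inl _, None => False
  | inr r, Some (x, y) => (ratr r) ^+ 2 < x ^+ 2 + y ^+ 2
  | inr _, None => True
  end.

(* closure (in Chat) of the basic open set coded by a valid b *)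
Definition in_basic_cl (R : realType) (b : basic) (z : Chat R) : Prop :=
  match b, z with
  | inl ((a, b'), (c, d)), Some (x, y) =>
      ratr a <= x /\ x <= ratr b' /\ ratr c <= y /\ y <= ratr d
  | inl _, None => False
  | inr r, Some (x, y) => (ratr r) ^+ 2 <= x ^+ 2 + y ^+ 2
  | inr _, None => True
  end.

Definition copen (R : realType) (U : cset R) : Prop :=
  forall z, U z -> exists b, basic_valid b /\ in_basic b z /\
                       (forall w, in_basic b w -> U w).

Definition ccompl (R : realType) (S : cset R) : cset R := fun z => ~ S z.

Definition cclosure (R : realType) (S : cset R) : cset R :=
  fun z => forall b, basic_valid b -> in_basic b z -> exists w, in_basic b w /\ S w.

Definition cinterior (R : realType) (S : cset R) : cset R :=
  fun z => exists b, basic_valid b /\ in_basic b z /\ (forall w, in_basic b w -> S w).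

Definition cboundary (R : realType) (S : cset R) : cset R :=
  fun z => cclosure S z /\ ~ cinterior S z.

Definition cconnected (R : realType) (S : cset R) : Prop :=
  ~ exists U V : cset R, copen U /\ copen V /\
      (forall z, S z -> U z \/ V z) /\
      (exists z, S z /\ U z) /\ (exists z, S z /\ V z) /\
      (forall z, ~ (S z /\ U z /\ V z)).

Definition ccomponent_of (R : realType) (S : cset R) (x : Chat R) : cset R :=
  fun z => exists T : cset R, cconnected T /\ (forall w, T w -> S w) /\ T x /\ T z.

Definition is_component (R : realType) (S K : cset R) : Prop :=
  exists x, S x /\ forall z, K z <-> ccomponent_of S x z.

Definition cdomain (R : realType) (D : cset R) : Prop :=
  copen D /\ cconnected D /\ exists z, D z.

Definition component_labeling (R : realType) (S : cset R) (n : nat)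
    (C : 'I_n -> cset R) : Prop :=
  (forall l, is_component S (C l)) /\
  (forall l l', (forall z, C l z <-> C l' z) -> l = l') /\
  (forall K, is_component S K -> exists l, forall z, K z <-> C l z).

(* Names.  A name lists (with padding symbol 0, repetitions allowed) a set   *)
(* of basic open sets: p k = 0 is "no entry", p k = (pickle b).+1 lists b.   *)
Definition lists_exactly (P : basic -> Prop) (p : nat -> nat) : Prop :=
  (forall k, p k = 0%N \/ exists b, P b /\ p k = (pickle b).+1) /\
  (forall b, P b -> exists k, p k = (pickle b).+1).

Definition open_name (R : realType) (U : cset R) (p : nat -> nat) : Prop :=
  lists_exactly (fun b => basic_valid b /\ forall z, in_basic_cl b z -> U z) p.

Definition closed_name (R : realType) (C : cset R) (p : nat -> nat) : Prop :=
  lists_exactly (fun b => basic_valid b /\ exists z, in_basic b z /\ C z) p.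

Definition substream (q : nat -> nat) (i : nat) : nat -> nat :=
  fun j => q (cpair i j).

(* Output specification: streams 2l and 2l+1 (l < n) are names of
   Chat \ D_{0,l+1} and of the boundary of D_{0,l+1}, where
   D_{0,1}, ..., D_{0,n} is a labeling of the components of Chat \ D. *)
Definition valid_output (R : realType) (D : cset R) (n : nat) (q : nat -> nat) : Prop :=
  exists C : 'I_n -> cset R,
    component_labeling (ccompl D) C /\
    forall l : 'I_n,
      open_name (ccompl (C l)) (substream q (2 * l)) /\
      closed_name (cboundary (C l)) (substream q (2 * l).+1).

(* Main.v *)
(* Let K be the complement of D. Lay a grid over a box that contains K and take around
   each grid point the open square whose half-side is the mesh. Search for a labelling
   of the grid points by 0, ..., n such that squares labelled 0 have their closure in D,
   neighbouring nonzero labels agree, and each label 1, ..., n has a square that meets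
   the boundary of D: all this is confirmed by finitely many entries of the two names.
   The n unions of squares with equal nonzero label are then open, disjoint, cover K and
   each meet K, so, K having n components, each contains exactly one of them. The search
   succeeds because the components have positive distance, and because each of them meets
   the closure of D, the sphere being connected.

   Once a labelling is fixed, the closure of a basic set b misses the component of label
   l iff on some finer grid every square misses the closure of b, or has its closure in
   D, or lies in a square not labelled l (by compactness of the box); and b meets the
   boundary of this component iff on some finer grid a square inside b, lying in a square
   labelled l, meets the boundary of D. Both conditions are semidecidable. *)
Require Import Defs.
From mathcomp Require Import all_boot all_order all_algebra.
From mathcomp Require Import all_classical reals interval_inference topology normedtype.
From mathcomp Require Import zify ring lra.

Set Implicit Arguments.
Unset Strict Implicit.
Unset Printing Implicit Defensive.
Import Order.TTheory GRing.Theory Num.Theory.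
Import numFieldNormedType.Exports.

(** * Computable functions of natural numbers *)

Lemma all_iotaP (P : pred nat) m : reflect (forall i, i < m -> P i) (all P (iota 0 m)).
Proof.
apply: (iffP allP) => [allP i im|Pm i]; first by apply: allP; rewrite mem_iota.
by rewrite mem_iota => /andP[_]; apply: Pm.
Qed.

Lemma has_iotaP (P : pred nat) m : reflect (exists2 i, i < m & P i) (has P (iota 0 m)).
Proof.
apply: (iffP hasP) => [[i]|[i im Pi]]; first by rewrite mem_iota => /andP[_]; exists i.
by exists i; rewrite ?mem_iota.
Qed.

Definition all_pairs (m : nat) (P : nat -> nat -> bool) : bool :=
  all (fun i => all (fun j => P i j) (iota 0 m)) (iota 0 m).

Definition has_pair (m : nat) (P : nat -> nat -> bool) : bool :=
  has (fun i => has (fun j => P i j) (iota 0 m)) (iota 0 m).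

Lemma all_pairsP m (P : nat -> nat -> bool) :
  reflect (forall i j, i < m -> j < m -> P i j) (all_pairs m P).
Proof.
apply: (iffP (all_iotaP _ _)) => PP i; first by move=> j im jm; exact: (all_iotaP _ _ (PP i im)).
by move=> im; apply/all_iotaP => j jm; apply: PP.
Qed.

Lemma has_pairP m (P : nat -> nat -> bool) :
  reflect (exists i j, [/\ i < m, j < m & P i j]) (has_pair m P).
Proof.
apply: (iffP (has_iotaP _ _)) => [[i im /has_iotaP[j jm Pij]]|[i [j [im jm Pij]]]].
  by exists i, j.
by exists i => //; apply/has_iotaP; exists j.
Qed.

Lemma find_iota (P : pred nat) b x :
  x <= b -> (forall y, y < x -> ~~ P y) -> (x < b -> P x) -> find P (iota 0 b) = x.
Proof.
move=> xb nP; rewrite -(subnKC xb) iotaD find_cat size_iota add0n ifF; last first.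
  by apply/has_iotaP => -[y /nP/negP].
by case: (b - x) => [_|m] /=; rewrite ?addn0 // -addSnnS leq_addr => ->; rewrite ?addn0.
Qed.

Definition computable (k : nat) (f : seq nat -> nat) : Prop :=
  exists r, forall v, size v = k -> rf_eval r v (f v).

Lemma eq_computable k f g :
  (forall v, size v = k -> f v = g v) -> computable k f -> computable k g.
Proof. by move=> fg [r rP]; exists r => v sv; rewrite -fg //; apply: rP. Qed.

Lemma computable_nth k i : i < k -> computable k (fun v => nth 0 v i).
Proof. by move=> ik; exists (RProj i) => v sv; apply: ev_proj; rewrite sv. Qed.

Lemma computable_head k : computable k.+1 (fun v => head 0 v).
Proof. by apply: eq_computable (@computable_nth k.+1 0 isT) => v; rewrite nth0. Qed.

Lemma computable_comp k m F (gs : seq (seq nat -> nat)) :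
  computable m F -> size gs = m ->
  (forall i, i < m -> computable k (nth (fun=> 0) gs i)) ->
  computable k (fun v => F [seq g v | g <- gs]).
Proof.
move=> [r rP] sgs cgs.
have [rs rsP] : exists rs, forall v, size v = k ->
    rf_evals rs v [seq g v | g <- gs].
  rewrite -{}sgs in cgs; elim: gs cgs => [|g gs IH] cgs.
    by exists [::] => v _; apply: evs_nil.
  have [rs rsP] := IH (fun i => cgs i.+1); have [r1 r1P] := cgs 0 isT.
  by exists (r1 :: rs) => v sv /=; apply: evs_cons; [apply: r1P|apply: rsP].
exists (RComp r rs) => v sv; apply: (@ev_comp _ _ _ [seq g v | g <- gs]).
  exact: rsP.
by apply: rP; rewrite size_map.
Qed.

Lemma computable_comp1 k F f :
  computable 1 (fun v => F (head 0 v)) -> computable k f ->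
  computable k (fun v => F (f v)).
Proof.
by move=> cF cf; apply: (computable_comp cF (gs := [:: f])) => // -[].
Qed.

Lemma computable_behead k f :
  computable k f -> computable k.+1 (fun v => f (behead v)).
Proof.
move=> cf.
pose gs := [seq (fun w : seq nat => nth 0 w i.+1) | i <- iota 0 k].
have sgs : size gs = k by rewrite size_map size_iota.
apply: (@eq_computable _ (fun w => f [seq g w | g <- gs])).
  move=> w sw; congr f; apply: (@eq_from_nth _ 0).
    by rewrite size_map sgs size_behead sw.
  move=> i; rewrite size_map sgs => ik.
  by rewrite (nth_map (fun=> 0)) ?sgs// (nth_map 0) ?size_iota// nth_iota// nth_behead.
apply: computable_comp cf sgs _ => i ik.
rewrite (nth_map 0) ?size_iota// nth_iota//; exact: computable_nth.
Qed.

Lemma computable_rec k b st n :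
  computable k b -> computable k.+2 st -> computable k n ->
  computable k (fun v => nat_rect (fun=> nat) (b v) (fun i r => st (i :: r :: v)) (n v)).
Proof.
move=> [rb rbP] [rs rsP] cn.
have crec : computable k.+1 (fun w => nat_rect (fun=> nat) (b (behead w))
    (fun i r => st (i :: r :: behead w)) (head 0 w)).
  exists (RPrec rb rs) => -[|n0 v] //= [sv].
  elim: n0 => [|n0 IH] /=; first by apply: ev_prec0; apply: rbP.
  by apply: ev_precS IH _; apply: rsP; rewrite /= sv.
pose gs := n :: [seq (fun w : seq nat => nth 0 w i) | i <- iota 0 k].
have sgs : size gs = k.+1 by rewrite /= size_map size_iota.
apply: eq_computable (computable_comp (k := k) crec sgs _) => [v sv|[|i] ik] //=.
  rewrite -map_comp /comp.
  by have -> : [seq nth 0 v x | x <- iota 0 k] = v by rewrite -sv map_nth_iota0 ?take_size.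
rewrite (nth_map 0) ?size_iota// nth_iota//; exact: computable_nth.
Qed.

Lemma computable_const k c : computable k (fun=> c).
Proof.
elim: c => [|c [r rP]]; first by exists RZero => v _; apply: ev_zero.
exists (RComp RSucc [:: r]) => v sv; apply: (@ev_comp _ _ _ [:: c]).
  by apply: evs_cons (rP _ sv) (evs_nil _).
exact: ev_succ.
Qed.

Lemma computable_succ k f : computable k f -> computable k (fun v => (f v).+1).
Proof.
by apply: computable_comp1; exists RSucc => -[|x [|]] //= _; apply: ev_succ.
Qed.

Lemma computable_add k f g :
  computable k f -> computable k g -> computable k (fun v => f v + g v).
Proof.
move=> cf cg; have cst := computable_succ (@computable_nth k.+2 1 isT).
apply: eq_computable (computable_rec cf cst cg) => v _.
by elim: (g v) => [|m IH] /=; rewrite ?addn0 ?addnS ?IH.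
Qed.

Lemma computable_mul k f g :
  computable k f -> computable k g -> computable k (fun v => f v * g v).
Proof.
move=> cf cg; have cst := computable_add
  (computable_behead (computable_behead cf)) (@computable_nth k.+2 1 isT).
apply: eq_computable (computable_rec (computable_const k 0) cst cg) => v _ /=.
by elim: (g v) => [|m IH] /=; rewrite ?muln0 ?mulnS ?IH.
Qed.

Lemma computable_exp k f g :
  computable k f -> computable k g -> computable k (fun v => f v ^ g v).
Proof.
move=> cf cg; have cst := computable_mul
  (computable_behead (computable_behead cf)) (@computable_nth k.+2 1 isT).
apply: eq_computable (computable_rec (computable_const k 1) cst cg) => v _ /=.
by elim: (g v) => [|m IH] /=; rewrite ?expn0 ?expnS ?IH.
Qed.

Lemma computable_pred k f : computable k f -> computable k (fun v => (f v).-1).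
Proof.
move=> cf; have cst := @computable_nth k.+2 0 isT.
apply: eq_computable (computable_rec (computable_const k 0) cst cf) => v _ /=.
by case: (f v).
Qed.

Lemma computable_sub k f g :
  computable k f -> computable k g -> computable k (fun v => f v - g v).
Proof.
move=> cf cg; have cst := computable_pred (@computable_nth k.+2 1 isT).
apply: eq_computable (computable_rec cf cst cg) => v _ /=.
by elim: (g v) => [|m IH] /=; rewrite ?subn0 ?subnS ?IH.
Qed.

Lemma computable_iter k F n x :
  computable 1 (fun v => F (head 0 v)) -> computable k n -> computable k x ->
  computable k (fun v => iter (n v) F (x v)).
Proof.
move=> cF cn cx; have cst := computable_comp1 cF (@computable_nth k.+2 1 isT).
apply: eq_computable (computable_rec cx cst cn) => v _ /=.
by elim: (n v) => //= m ->.
Qed.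

Lemma computable_leq k f g :
  computable k f -> computable k g -> computable k (fun v => f v <= g v).
Proof.
move=> cf cg; have c1 := computable_sub (computable_const k 1) (computable_sub cf cg).
by apply: eq_computable c1 => v _; rewrite leqNgt; case: ltnP; lia.
Qed.

Lemma computable_negb k (p : seq nat -> bool) :
  computable k p -> computable k (fun v => ~~ p v).
Proof.
move=> cp; apply: eq_computable (computable_sub (computable_const k 1) cp) => v _.
by case: (p v).
Qed.

Lemma computable_andb k (p q : seq nat -> bool) :
  computable k p -> computable k q -> computable k (fun v => p v && q v).
Proof.
move=> cp cq; apply: eq_computable (computable_mul cp cq) => v _.
by case: (p v); case: (q v).
Qed.

Lemma computable_orb k (p q : seq nat -> bool) :
  computable k p -> computable k q -> computable k (fun v => p v || q v).
Proof.
move=> cp cq; apply: eq_computable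
  (computable_negb (computable_andb (computable_negb cp) (computable_negb cq))) => v _.
by case: (p v); case: (q v).
Qed.

Lemma computable_eq k f g :
  computable k f -> computable k g -> computable k (fun v => f v == g v).
Proof.
move=> cf cg.
have c := computable_andb (computable_leq cf cg) (computable_leq cg cf).
by apply: eq_computable c => v _; rewrite eqn_leq.
Qed.

Lemma computable_if k (p : seq nat -> bool) f g :
  computable k p -> computable k f -> computable k g ->
  computable k (fun v => if p v then f v else g v).
Proof.
move=> cp cf cg; apply: eq_computable (computable_add (computable_mul cp cf)
  (computable_mul (computable_negb cp) cg)) => v _.
by case: (p v); rewrite /= ?mul1n ?mul0n ?addn0.
Qed.

Lemma computable_if_bool k (p q r : seq nat -> bool) :
  computable k p -> computable k q -> computable k r ->
  computable k (fun v => if p v then q v else r v).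
Proof.
move=> cp cq cr; apply: eq_computable (computable_if cp cq cr) => v _.
by case: (p v).
Qed.

Lemma computable_find k (P : nat -> seq nat -> bool) b :
  computable k.+1 (fun w => P (head 0 w) (behead w)) -> computable k b ->
  computable k (fun v => find (fun i => P i v) (iota 0 (b v))).
Proof.
move=> cP cb; have [r rP] := computable_andb (computable_negb cP)
  (computable_leq (computable_succ (computable_head k)) (computable_behead cb)).
exists (RMu r) => v sv; set t := find _ _.
have r_at m y : ~~ P m v && (m < b v) = y -> rf_eval r (m :: v) y.
  by move=> <-; apply: (rP (m :: v)); rewrite /= sv.
have tb : t <= b v by rewrite -[b v](size_iota 0); apply: find_size.
apply: ev_mu => [|m mt].
  apply: (r_at _ false); apply/negP => /andP[/negP nPt tb'].
  have : has (P^~ v) (iota 0 (b v)) by rewrite has_find size_iota.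
  by move/(nth_find 0); rewrite nth_iota.
exists 0; apply: (r_at _ true); rewrite (leq_trans mt tb) andbT.
by have := before_find 0 mt; rewrite nth_iota ?(leq_trans mt tb) // add0n => ->.
Qed.

Lemma computable_has k (P : nat -> seq nat -> bool) b :
  computable k.+1 (fun w => P (head 0 w) (behead w)) -> computable k b ->
  computable k (fun v => has (fun i => P i v) (iota 0 (b v))).
Proof.
move=> cP cb; apply: eq_computable
  (computable_leq (computable_succ (computable_find cP cb)) cb) => v _.
by rewrite has_find size_iota.
Qed.

Lemma computable_all k (P : nat -> seq nat -> bool) b :
  computable k.+1 (fun w => P (head 0 w) (behead w)) -> computable k b ->
  computable k (fun v => all (fun i => P i v) (iota 0 (b v))).
Proof.
move=> cP cb; apply: eq_computable (computable_negb
  (computable_has (P := fun i v => ~~ P i v) (computable_negb cP) cb)) => v _.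
by rewrite -[all _ _]negbK -has_predC.
Qed.

Create HintDb computable.

Ltac computable_under_binder :=
  repeat match goal with comp : computable ?k _ |- computable (S ?k) _ =>
    apply computable_behead in comp end;
  match goal with |- computable (S ?k) _ => pose proof (@computable_head k) end;
  cbv beta in *.

#[export] Hint Resolve computable_const computable_succ computable_add
  computable_mul computable_exp computable_pred computable_sub computable_leq
  computable_negb computable_andb computable_orb computable_eq
  computable_if computable_if_bool : computable.
#[export] Hint Extern 1 (computable _ (fun v => find _ (iota 0 _))) =>
  simple apply computable_find; [computable_under_binder|] : computable.
#[export] Hint Extern 1 (computable _ (fun v => nat_of_bool (has _ (iota 0 _)))) =>
  simple apply computable_has; [computable_under_binder|] : computable.
#[export] Hint Extern 1 (computable _ (fun v => nat_of_bool (all _ (iota 0 _)))) =>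
  simple apply computable_all; [computable_under_binder|] : computable.

Ltac computability := solve [auto 100 with computable].

Lemma computable_div k f g :
  computable k f -> computable k g -> computable k (fun v => f v %/ g v).
Proof.
move=> cf cg; apply: (@eq_computable _ (fun v => if g v == 0 then 0 else
  find (fun q => f v < q.+1 * g v) (iota 0 (f v)))); last by computability.
move=> v _; case: posnP => [->|g0]; first by rewrite divn0.
apply: find_iota; first exact: leq_div.
  by move=> y; rewrite -leqNgt leq_divRL.
by rewrite -ltn_divLR.
Qed.
#[export] Hint Resolve computable_div : computable.

Lemma computable_mod k f g :
  computable k f -> computable k g -> computable k (fun v => f v %% g v).
Proof.
move=> cf cg; apply: (@eq_computable _ (fun v => f v - f v %/ g v * g v)).
  by move=> v _; rewrite {1}(divn_eq (f v) (g v)) addKn.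
computability.
Qed.
#[export] Hint Resolve computable_mod : computable.

(** * Pairs and words *)

Lemma double_half_mulnS s : (s * s.+1)./2.*2 = s * s.+1.
Proof. by rewrite -[RHS]odd_double_half oddM /= andbN. Qed.

Lemma ltn_add_cpair x y x' y' : x + y < x' + y' -> cpair x y < cpair x' y'.
Proof.
rewrite /cpair => lts.
by have := double_half_mulnS (x + y); have := double_half_mulnS (x' + y'); nia.
Qed.

Lemma cpair_inj x y x' y' : cpair x y = cpair x' y' -> x = x' /\ y = y'.
Proof.
move=> eq_code; have eq_sum : x + y = x' + y'.
  by case: (ltngtP (x + y) (x' + y')) => // /ltn_add_cpair; rewrite eq_code ltnn.
by move: eq_code; rewrite /cpair eq_sum; lia.
Qed.

Lemma leq_cpairl x y : x <= cpair x y.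
Proof. by rewrite /cpair; have := double_half_mulnS (x + y); nia. Qed.

Lemma leq_cpairr x y : y <= cpair x y.
Proof. by rewrite /cpair leq_addl. Qed.

Lemma computable_cpair k f g :
  computable k f -> computable k g -> computable k (fun v => cpair (f v) (g v)).
Proof.
move=> cf cg; apply: (@eq_computable _
  (fun v => ((f v + g v) * (f v + g v).+1) %/ 2 + g v)).
  by move=> v _; rewrite /cpair divn2.
computability.
Qed.
#[export] Hint Resolve computable_cpair : computable.

(* [find] returns the bound [z] if it finds nothing below, which is then the component
   sought since both components of a pair are at most its code. *)
Definition unpair1 (z : nat) : nat :=
  find (fun x => has (fun y => cpair x y == z) (iota 0 z.+1)) (iota 0 z).

Definition unpair2 (z : nat) : nat :=
  find (fun y => has (fun x => cpair x y == z) (iota 0 z.+1)) (iota 0 z).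

Lemma cpairK1 x y : unpair1 (cpair x y) = x.
Proof.
apply: find_iota; first exact: leq_cpairl.
  by move=> x' x'x; apply/has_iotaP => -[y' _ /eqP/cpair_inj[x'E _]]; rewrite x'E ltnn in x'x.
by move=> _; apply/has_iotaP; exists y; rewrite // ltnS leq_cpairr.
Qed.

Lemma cpairK2 x y : unpair2 (cpair x y) = y.
Proof.
apply: find_iota; first exact: leq_cpairr.
  by move=> y' y'y; apply/has_iotaP => -[x' _ /eqP/cpair_inj[_ y'E]]; rewrite y'E ltnn in y'y.
by move=> _; apply/has_iotaP; exists x; rewrite // ltnS leq_cpairl.
Qed.

Lemma leq_unpair2 z : unpair2 z <= z.
Proof. by rewrite -{2}(size_iota 0 z); apply: find_size. Qed.

Lemma computable_unpair1 k f : computable k f -> computable k (fun v => unpair1 (f v)).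
Proof. by move=> cf; rewrite /unpair1; computability. Qed.

Lemma computable_unpair2 k f : computable k f -> computable k (fun v => unpair2 (f v)).
Proof. by move=> cf; rewrite /unpair2; computability. Qed.
#[export] Hint Resolve computable_unpair1 computable_unpair2 : computable.

Definition word_behead (u : nat) : nat := unpair2 u.-1.
Definition word_nth (u i : nat) : nat := unpair1 (iter i word_behead u).-1.
Definition word_size (u : nat) : nat :=
  find (fun i => iter i word_behead u == 0) (iota 0 u).

Lemma iter_word_behead w i : iter i word_behead (code_word w) = code_word (drop i w).
Proof.
elim: i => [|i IH]; first by rewrite drop0.
rewrite iterS IH -[i.+1]add1n -drop_drop; case: (drop i w) => [|x s] /=.
  by rewrite /word_behead /= -[0]/(cpair 0 0) cpairK2.
by rewrite /word_behead /= cpairK2 drop0.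
Qed.

Lemma word_nth_code w i : i < size w -> word_nth (code_word w) i = nth 0 w i.
Proof. by move=> iw; rewrite /word_nth iter_word_behead (drop_nth 0 iw) /= cpairK1. Qed.

Lemma word_size_code w : word_size (code_word w) = size w.
Proof.
apply: find_iota.
- by elim: w => //= x w IH; rewrite ltnS (leq_trans IH) ?leq_cpairr.
- by move=> i iw; rewrite iter_word_behead (drop_nth 0 iw).
- by move=> _; rewrite iter_word_behead drop_size.
Qed.

Lemma word_nth_prefix p m i : i < m -> word_nth (code_word (Defs.prefix p m)) i = p i.
Proof. by move=> im; rewrite word_nth_code ?size_mkseq // nth_mkseq. Qed.

Lemma word_size_prefix p m : word_size (code_word (Defs.prefix p m)) = m.
Proof. by rewrite word_size_code size_mkseq. Qed.

Lemma computable_word_behead : computable 1 (fun v => word_behead (head 0 v)).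
Proof. by have c0 := computable_head 0; rewrite /word_behead; computability. Qed.

Lemma computable_word_nth k f g :
  computable k f -> computable k g -> computable k (fun v => word_nth (f v) (g v)).
Proof.
move=> cf cg; have := computable_iter computable_word_behead cg cf.
by rewrite /word_nth; computability.
Qed.

Lemma computable_word_size k f :
  computable k f -> computable k (fun v => word_size (f v)).
Proof.
move=> cf; rewrite /word_size; apply: computable_find => //.
apply: computable_eq; last by computability.
exact: computable_iter computable_word_behead (@computable_head k) (computable_behead cf).
Qed.
#[export] Hint Resolve computable_word_nth computable_word_size : computable.

(** * Computable functions with rational values *)

Definition computable_rat (k : nat) (q : seq nat -> rat) : Prop :=
  exists a b d, [/\ computable k a, computable k b, computable k d &
    forall v, size v = k -> q v = (((a v)%:R - (b v)%:R) / (d v).+1%:R)%R].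

Section ComputableRat.
Variable k : nat.
Implicit Types (q r : seq nat -> rat) (f : seq nat -> nat).
Local Open Scope ring_scope.

Lemma eq_computable_rat q r :
  (forall v, size v = k -> q v = r v) -> computable_rat k q -> computable_rat k r.
Proof.
move=> qr [a [b [d [ca cb cd qE]]]]; exists a, b, d; split=> // v sv.
by rewrite -qr // qE.
Qed.

Lemma computable_rat_nat f : computable k f -> computable_rat k (fun v => (f v)%:R).
Proof.
move=> cf; exists f, (fun=> 0%N), (fun=> 0%N); split; try by computability.
by move=> v _; rewrite subr0 divr1.
Qed.

Lemma computable_rat_add q r :
  computable_rat k q -> computable_rat k r -> computable_rat k (fun v => q v + r v).
Proof.
move=> [a [b [d [ca cb cd qE]]]] [a' [b' [d' [ca' cb' cd' rE]]]].
exists (fun v => a v * (d' v).+1 + a' v * (d v).+1)%N,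
  (fun v => b v * (d' v).+1 + b' v * (d v).+1)%N, (fun v => ((d v).+1 * (d' v).+1).-1)%N.
split; try by computability.
move=> v sv; rewrite qE // rE // prednK // !natrD !natrM.
by field; rewrite !nat1r !pnatr_eq0.
Qed.

Lemma computable_rat_opp q : computable_rat k q -> computable_rat k (fun v => - q v).
Proof.
move=> [a [b [d [ca cb cd qE]]]]; exists b, a, d; split=> // v sv.
by rewrite qE // -mulNr opprB.
Qed.

Lemma computable_rat_mul q r :
  computable_rat k q -> computable_rat k r -> computable_rat k (fun v => q v * r v).
Proof.
move=> [a [b [d [ca cb cd qE]]]] [a' [b' [d' [ca' cb' cd' rE]]]].
exists (fun v => a v * a' v + b v * b' v)%N,
  (fun v => a v * b' v + b v * a' v)%N, (fun v => ((d v).+1 * (d' v).+1).-1)%N.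
split; try by computability.
move=> v sv; rewrite qE // rE // prednK // !natrD !natrM.
by field; rewrite !nat1r !pnatr_eq0.
Qed.

Lemma computable_rat_expr q n :
  computable_rat k q -> computable_rat k (fun v => q v ^+ n).
Proof.
move=> cq; elim: n => [|n IH].
  by apply: eq_computable_rat (computable_rat_nat (computable_const k 1)) => v _.
by apply: eq_computable_rat (computable_rat_mul cq IH) => v _; rewrite exprS.
Qed.

Lemma computable_rat_inv q : computable_rat k q -> computable_rat k (fun v => (q v)^-1).
Proof.
move=> [a [b [d [ca cb cd qE]]]].
exists (fun v => if b v < a v then (d v).+1 else 0)%N,
  (fun v => if a v < b v then (d v).+1 else 0)%N, (fun v => (a v - b v + (b v - a v)).-1)%N.
split; try by computability.
move=> v sv; rewrite qE //; case: ltngtP => [ba|ab|->].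
- rewrite (eqP (ltnW ba)) addn0 prednK ?subn_gt0 // natrB ?(ltnW ba) // subr0.
  by rewrite invf_div.
- rewrite (eqP (ltnW ab)) add0n prednK ?subn_gt0 // natrB ?(ltnW ab) // sub0r.
  by rewrite invf_div -opprB invrN mulrN mulNr.
- by rewrite !subrr !mul0r invr0.
Qed.

Lemma computable_rat_le q r :
  computable_rat k q -> computable_rat k r -> computable k (fun v => q v <= r v).
Proof.
move=> [a [b [d [ca cb cd qE]]]] [a' [b' [d' [ca' cb' cd' rE]]]].
apply: (@eq_computable _ (fun v => a v * (d' v).+1 + b' v * (d v).+1
                                   <= a' v * (d v).+1 + b v * (d' v).+1)%N).
  move=> v sv; rewrite qE // rE // ler_pdivrMr // mulrAC ler_pdivlMr //.
  rewrite -(ler_nat rat) !natrD !natrM; congr nat_of_bool; apply/idP/idP; lra.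
by computability.
Qed.

Lemma computable_rat_lt q r :
  computable_rat k q -> computable_rat k r -> computable k (fun v => q v < r v).
Proof.
move=> cq cr; apply: eq_computable (computable_negb (computable_rat_le cr cq)) => v _.
by rewrite -ltNge.
Qed.

Lemma computable_rat_if (p : seq nat -> bool) q r :
  computable k p -> computable_rat k q -> computable_rat k r ->
  computable_rat k (fun v => if p v then q v else r v).
Proof.
move=> cp cq cr; apply: eq_computable_rat (computable_rat_add
  (computable_rat_mul (computable_rat_nat cp) cq)
  (computable_rat_mul (computable_rat_nat (computable_negb cp)) cr)) => v _.
by case: (p v); rewrite /= mul1r mul0r ?addr0 ?add0r.
Qed.

Lemma computable_rat_max q r :
  computable_rat k q -> computable_rat k r ->
  computable_rat k (fun v => Num.max (q v) (r v)).
Proof. by move=> cq cr; apply: computable_rat_if => //; apply: computable_rat_lt. Qed.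

Lemma computable_rat_norm q : computable_rat k q -> computable_rat k (fun v => `|q v|).
Proof.
move=> cq; apply: eq_computable_rat (computable_rat_max (computable_rat_opp cq) cq).
by move=> v _; rewrite maxNr.
Qed.
End ComputableRat.

(** * Codes of rational numbers and of basic open sets *)

Section Pickle.
Variable k : nat.

Lemma computable_code2 f g :
  computable k f -> computable k g -> computable k (fun v => CodeSeq.code [:: f v; g v]).
Proof.
move=> cf cg; apply: (@eq_computable _ (fun v => 2 ^ f v * (2 * 2 ^ g v).+1)).
  by move=> v _; rewrite /= muln1 mul2n.
by computability.
Qed.

Lemma computable_code1 f : computable k f -> computable k (fun v => CodeSeq.code [:: f v]).
Proof.
move=> cf; apply: (@eq_computable _ (fun v => 2 ^ f v)); last by computability.
by move=> v _; rewrite /= muln1.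
Qed.

Lemma computable_pickle_pair (T1 T2 : countType) (x : seq nat -> T1) (y : seq nat -> T2) :
  computable k (fun v => pickle (x v)) -> computable k (fun v => pickle (y v)) ->
  computable k (fun v => pickle (x v, y v)).
Proof. exact: computable_code2. Qed.

Lemma computable_pickle_inl (T1 T2 : countType) (x : seq nat -> T1) :
  computable k (fun v => pickle (x v)) ->
  computable k (fun v => pickle (inl (x v) : T1 + T2)).
Proof. by move=> cx; apply: (computable_code2 (computable_code1 cx) (computable_const k 0)). Qed.

Lemma computable_pickle_inr (T1 T2 : countType) (x : seq nat -> T2) :
  computable k (fun v => pickle (x v)) ->
  computable k (fun v => pickle (inr (x v) : T1 + T2)).
Proof. by move=> cx; apply: (computable_code2 (computable_const k 0) (computable_code1 cx)). Qed.

Lemma computable_pickle_int f g :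
  computable k f -> computable k g ->
  computable k (fun v => pickle ((f v)%:Z - (g v)%:Z)%R).
Proof.
move=> cf cg; apply: (@eq_computable _ (fun v => if g v <= f v
  then pickle (inl (f v - g v) : nat + nat)
  else pickle (inr (g v - f v).-1 : nat + nat))).
  move=> v _; case: leqP => [gf|fg]; first by rewrite subzn.
  by rewrite -opprB subzn ?(ltnW fg) // -[in RHS](@prednK (g v - f v)) ?subn_gt0 // -NegzE.
apply: computable_if; first by computability.
  exact: (computable_pickle_inl (T1 := nat) _ (computable_sub cf cg)).
exact: (computable_pickle_inr (T2 := nat) _ (computable_pred (computable_sub cg cf))).
Qed.

Lemma numq_cross_mul (x y : int) :
  (y != 0 -> numq (x%:Q / y%:Q) * y = x * denq (x%:Q / y%:Q))%R.
Proof. by case: divqP => [_|g z _ _]; rewrite ?eqxx // mulrCA mulrA. Qed.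

Lemma denq_find (m d : nat) (x : int) : `|x|%N = m ->
  `|denq (x%:Q / d.+1%:Q)|%N = (find (fun e => d.+1 %| m * e.+1) (iota 0 d)).+1.
Proof.
move=> xm; set q := (_ / _)%R.
have den_gt0 : 0 < `|denq q|%N by rewrite absz_gt0 denq_neq0.
have cross : `|numq q|%N * d.+1 = m * `|denq q|%N.
  by have /(congr1 absz) := @numq_cross_mul x d.+1 isT; rewrite !abszM xm.
have clears e : (d.+1 %| m * e) = (`|denq q|%N %| e).
  rewrite -(@dvdn_pmul2r `|denq q|%N) // mulnAC -cross mulnAC mulnC.
  by rewrite dvdn_pmul2r // Gauss_dvdr // coprime_sym coprime_num_den.
rewrite (@find_iota _ _ `|denq q|%N.-1) ?prednK // => [|e lt_e|_].
- by rewrite -ltnS prednK // dvdn_leq // -clears mulnC dvdn_mulr.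
- by rewrite clears; apply/negP => /(dvdn_leq (ltn0Sn _)); lia.
- by rewrite clears.
Qed.

Lemma computable_rat_pickle q : computable_rat k q -> computable k (fun v => pickle (q v)).
Proof.
move=> [a [b [d [ca cb cd qE]]]].
pose den v := (find (fun e => (d v).+1 %| (a v - b v + (b v - a v)) * e.+1) (iota 0 (d v))).+1.
have cden : computable k den by rewrite /den /dvdn; computability.
pose num v := ((a v - b v + (b v - a v)) * den v) %/ (d v).+1.
pose pos v := if b v <= a v then num v else 0.
pose neg v := if b v <= a v then 0 else num v.
apply: (@eq_computable _ (fun v =>
  pickle (((pos v)%:Z - (neg v)%:Z)%R, ((den v)%:Z - 0%:Z)%R))); last first.
  apply: computable_pickle_pair; apply: computable_pickle_int; rewrite /pos /neg /num;
  by computability.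
move=> v sv; rewrite [RHS]/(pickle (numq (q v), denq (q v))) subr0.
have {qE}qE : q v = (((a v)%:Z - (b v)%:Z)%:Q / (d v).+1%:Q)%R by rewrite qE // rmorphB.
have absE : `|((a v)%:Z - (b v)%:Z)%R|%N = a v - b v + (b v - a v) by lia.
have denE : denq (q v) = den v by rewrite -absz_denq qE (denq_find _ absE).
have := @numq_cross_mul ((a v)%:Z - (b v)%:Z)%R (d v).+1 isT.
rewrite -qE denE => cross; congr (pickle (_, _)).
have numE : num v = `|numq (q v)|%N.
  by rewrite /num -absE -[den v]/(`|Posz (den v)|%N) -abszM -cross abszM mulnK.
have den0 : 0 < den v by [].
by rewrite /pos /neg {}numE; case: leqP => ab; nia.
Qed.
End Pickle.
#[export] Hint Resolve computable_rat_pickle : computable.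

Definition rat_of_code (x : nat) : rat :=
  (((unpair1 x)%:R - (unpair1 (unpair2 x))%:R) / (unpair2 (unpair2 x)).+1%:R)%R.

Lemma rat_of_code_surj q : exists x, rat_of_code x = q.
Proof.
have [a [b numE]] : exists a b : nat, numq q = (a%:Z - b%:Z)%R.
  by case: (numq q) => n; [exists n, 0|exists 0, n.+1]; rewrite ?NegzE; lia.
have denE : Posz `|denq q|.-1.+1 = denq q by have := denq_gt0 q; lia.
exists (cpair a (cpair b `|denq q|.-1)); rewrite /rat_of_code !(cpairK1, cpairK2).
by rewrite -[RHS]divq_num_den numE -denE rmorphB.
Qed.

Lemma computable_rat_of_code k f :
  computable k f -> computable_rat k (fun v => rat_of_code (f v)).
Proof.
move=> cf; exists (fun v => unpair1 (f v)), (fun v => unpair1 (unpair2 (f v))),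
  (fun v => unpair2 (unpair2 (f v))); split=> //; computability.
Qed.

Lemma computable_rat_const k q : computable_rat k (fun=> q).
Proof.
by have [x <-] := rat_of_code_surj q; apply: computable_rat_of_code (computable_const k x).
Qed.

Definition basic_of_code (f : nat) : basic :=
  let x := unpair1 (unpair2 f) in let y := unpair2 (unpair2 f) in
  if unpair1 f == 0 then inl ((rat_of_code (unpair1 x), rat_of_code (unpair2 x)),
                              (rat_of_code (unpair1 y), rat_of_code (unpair2 y)))
  else inr (rat_of_code x).

Lemma basic_of_code_surj b : exists f, basic_of_code f = b.
Proof.
case: b => [[[a b] [c d]]|r].
  have [[xa <-] [xb <-]] := (rat_of_code_surj a, rat_of_code_surj b).
  have [[xc <-] [xd <-]] := (rat_of_code_surj c, rat_of_code_surj d).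
  exists (cpair 0 (cpair (cpair xa xb) (cpair xc xd))).
  by rewrite /basic_of_code !(cpairK1, cpairK2).
have [x <-] := rat_of_code_surj r; exists (cpair 1 (cpair x 0)).
by rewrite /basic_of_code !(cpairK1, cpairK2).
Qed.

#[export] Hint Resolve computable_rat_nat computable_rat_add computable_rat_opp
  computable_rat_mul computable_rat_expr computable_rat_inv computable_rat_le
  computable_rat_lt computable_rat_max computable_rat_norm computable_rat_of_code
  computable_rat_const : computable.

Lemma computable_basic_case k (P : basic -> seq nat -> nat) f :
  computable k f ->
  (forall a b c d, computable_rat k a -> computable_rat k b ->
     computable_rat k c -> computable_rat k d ->
     computable k (fun v => P (inl ((a v, b v), (c v, d v))) v)) ->
  (forall r, computable_rat k r -> computable k (fun v => P (inr (r v)) v)) ->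
  computable k (fun v => P (basic_of_code (f v)) v).
Proof.
move=> cf cinl cinr; apply: eq_computable (computable_if (p := fun v => unpair1 (f v) == 0) _
  (cinl (fun v => rat_of_code (unpair1 (unpair1 (unpair2 (f v)))))
        (fun v => rat_of_code (unpair2 (unpair1 (unpair2 (f v)))))
        (fun v => rat_of_code (unpair1 (unpair2 (unpair2 (f v)))))
        (fun v => rat_of_code (unpair2 (unpair2 (unpair2 (f v))))) _ _ _ _)
  (cinr (fun v => rat_of_code (unpair1 (unpair2 (f v)))) _)); try by computability.
by move=> v _; rewrite /basic_of_code; case: eqP.
Qed.

Lemma computable_pickle_rectangle k a b c d :
  computable_rat k a -> computable_rat k b -> computable_rat k c -> computable_rat k d ->
  computable k (fun v => pickle (inl ((a v, b v), (c v, d v)) : basic)).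
Proof.
by move=> *; apply: computable_pickle_inl; do 2?apply: computable_pickle_pair;
   apply: computable_rat_pickle.
Qed.

Lemma computable_pickle_exterior k r :
  computable_rat k r -> computable k (fun v => pickle (inr (r v) : basic)).
Proof. by move=> *; apply: computable_pickle_inr; apply: computable_rat_pickle. Qed.
#[export] Hint Resolve computable_pickle_rectangle computable_pickle_exterior : computable.

Lemma computable_pickle_basic k f :
  computable k f -> computable k (fun v => pickle (basic_of_code (f v))).
Proof.
by move=> cf; apply: (@computable_basic_case _ (fun b _ => pickle b)) => // *; computability.
Qed.
#[export] Hint Resolve computable_pickle_basic : computable.

(** * Machines that search for a parameter *)

Fixpoint rf_eval_det r v y (ev : rf_eval r v y) {struct ev} :
  forall y', rf_eval r v y' -> y = y'
with rf_evals_det rs v ys (evs : rf_evals rs v ys) {struct evs} :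
  forall ys', rf_evals rs v ys' -> ys = ys'.
Proof.
- case: ev => {r v y}.
  + by move=> v y' ev'; inversion ev'.
  + by move=> x v y' ev'; inversion ev'.
  + by move=> i v _ y' ev'; inversion ev'.
  + move=> f gs v ys y ev_gs ev_f y' ev'.
    inversion ev' as [| | |? ? ? ys' ? ev_gs' ev_f'| | |]; subst.
    by move: ev_f'; rewrite -(rf_evals_det _ _ _ ev_gs _ ev_gs') => /(rf_eval_det _ _ _ ev_f).
  + move=> f g v y ev_f y' ev'; inversion ev' as [| | | |? ? ? ? ev_f'| |]; subst.
    exact: rf_eval_det _ _ _ ev_f _ ev_f'.
  + move=> f g k v r y ev_r ev_g y' ev'.
    inversion ev' as [| | | | |? ? ? ? r' ? ev_r' ev_g'|]; subst.
    by move: ev_g'; rewrite -(rf_eval_det _ _ _ ev_r _ ev_r') => /(rf_eval_det _ _ _ ev_g).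
  + move=> f v k ev_k before_k k' ev'.
    inversion ev' as [| | | | | |? ? ? ev_k' before_k']; subst.
    case: (ltngtP k k') => // [/before_k'|/before_k] [r ev_r].
      by discriminate (rf_eval_det _ _ _ ev_k _ ev_r).
    by discriminate (rf_eval_det _ _ _ ev_r _ ev_k').
- case: evs => {rs v ys}.
  + by move=> v ys' evs'; inversion evs'.
  + move=> g gs v y ys ev_g ev_gs ys' evs'.
    inversion evs' as [|? ? ? y' ys1 ev_g' ev_gs']; subst.
    by rewrite (rf_eval_det _ _ _ ev_g _ ev_g') (rf_evals_det _ _ _ ev_gs _ ev_gs').
Qed.

Definition agree (m : nat) (p p' : nat -> nat) : Prop := forall k, k < m -> p k = p' k.

Definition reads (T : Type) (m : nat) (F : (nat -> nat) -> (nat -> nat) -> T) : Prop :=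
  forall p1 p1' p2 p2', agree m p1 p1' -> agree m p2 p2' -> F p1 p2 = F p1' p2'.

(* A test of [t] that reads only [t] symbols has the same outcome on all longer prefixes,
   so that the machine never changes its mind about the least solution. *)
Section SearchMachine.
Variable test : nat -> nat -> (nat -> nat) -> (nat -> nat) -> bool.
Variable out : nat -> nat -> nat -> (nat -> nat) -> (nat -> nat) -> nat.
Variable use : nat -> nat.

Hypothesis test_reads : forall n t, reads t (test n t).
Hypothesis out_reads : forall n t i, reads (use i) (out n t i).
Hypothesis test_computable : forall k n t u1 u2,
  computable k n -> computable k t -> computable k u1 -> computable k u2 ->
  computable k (fun v => test (n v) (t v) (word_nth (u1 v)) (word_nth (u2 v))).
Hypothesis out_computable : forall k n t i u1 u2,
  computable k n -> computable k t -> computable k i ->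
  computable k u1 -> computable k u2 ->
  computable k (fun v => out (n v) (t v) (i v) (word_nth (u1 v)) (word_nth (u2 v))).
Hypothesis use_computable : forall k i, computable k i -> computable k (fun v => use (i v)).

Definition search (n u1 u2 : nat) : nat :=
  find (fun t => test n t (word_nth u1) (word_nth u2)) (iota 0 (word_size u1)).

Definition search_answer (i n u1 u2 : nat) : nat :=
  if (search n u1 u2 < word_size u1) && (use i <= word_size u1)
  then (out n (search n u1 u2) i (word_nth u1) (word_nth u2)).+1 else 0.

Lemma computable_search_answer : computable 4
  (fun v => search_answer (nth 0 v 0) (nth 0 v 1) (nth 0 v 2) (nth 0 v 3)).
Proof.
have c_i := @computable_nth 4 0 isT; have c_n := @computable_nth 4 1 isT.
have c_u1 := @computable_nth 4 2 isT; have c_u2 := @computable_nth 4 3 isT.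
have c_search : computable 4 (fun v => search (nth 0 v 1) (nth 0 v 2) (nth 0 v 3)).
  exact: computable_find (test_computable (computable_behead c_n) (computable_head 4)
    (computable_behead c_u1) (computable_behead c_u2)) (computable_word_size c_u1).
by rewrite /search_answer; computability.
Qed.

Section FirstSolution.
Variables (n t : nat) (p1 p2 : nat -> nat).
Hypotheses (test_t : test n t p1 p2) (t_min : forall t', test n t' p1 p2 -> t <= t').

Lemma word_nth_agree p m i : i <= m -> agree i (word_nth (code_word (Defs.prefix p m))) p.
Proof. by move=> im k ki; rewrite word_nth_prefix // (leq_trans ki). Qed.

Lemma search_prefix m :
  search n (code_word (Defs.prefix p1 m)) (code_word (Defs.prefix p2 m)) = minn t m.
Proof.
have testE t' : t' <= m -> test n t' (word_nth (code_word (Defs.prefix p1 m)))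
    (word_nth (code_word (Defs.prefix p2 m))) = test n t' p1 p2.
  by move=> t'm; apply: test_reads; apply: word_nth_agree.
rewrite /search word_size_prefix; apply: find_iota; first exact: geq_minr.
  move=> t'; rewrite leq_min => /andP[t't t'm]; rewrite testE ?(ltnW t'm) //.
  by apply/negP => /t_min; rewrite leqNgt t't.
by rewrite gtn_min ltnn orbF => tm; rewrite (minn_idPl (ltnW tm)) testE // ltnW.
Qed.

Lemma search_answer_prefix i m :
  search_answer i n (code_word (Defs.prefix p1 m)) (code_word (Defs.prefix p2 m)) =
  if (t < m) && (use i <= m) then (out n t i p1 p2).+1 else 0.
Proof.
rewrite /search_answer search_prefix word_size_prefix gtn_min ltnn orbF.
case: ifP => // /andP[tm im]; rewrite (minn_idPl (ltnW tm)); congr S.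
by apply: out_reads; apply: word_nth_agree.
Qed.
End FirstSolution.

Lemma search_machine : exists M, rf_total4 M /\
  forall n p1 p2, (exists t, test n t p1 p2) ->
  exists2 t, test n t p1 p2 & machine_computes M n p1 p2 (fun i => out n t i p1 p2).
Proof.
have [M MP] := computable_search_answer; exists M.
have evM a b c d := MP [:: a; b; c; d] erefl.
split=> [a b c d|n p1 p2 ext]; first by exists (search_answer a b c d); apply: evM.
case: (ex_minnP ext) => t test_t t_min; exists t => //.
have answerE := search_answer_prefix test_t t_min; split=> [i|i m v].
  exists (maxn t.+1 (use i)); set m := maxn _ _.
  have := evM i n (code_word (Defs.prefix p1 m)) (code_word (Defs.prefix p2 m)).
  by rewrite /= answerE leq_maxl leq_maxr.
by move=> /(rf_eval_det (evM _ _ _ _)); rewrite /= answerE; case: ifP => // _ [].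
Qed.
End SearchMachine.

(** * Open partitions and finite families of closed sets *)

Local Open Scope classical_set_scope.
Local Open Scope ring_scope.

Section OpenPartition.
Variables (T : topologicalType) (I : choiceType) (U : I -> set T).
Hypotheses (openU : forall i, open (U i)) (disjU : trivIset setT U).

Lemma connected_sub_open_partition (A : set T) (i : I) :
  connected A -> A `<=` \bigcup_j U j -> A `&` U i !=set0 -> A `<=` U i.
Proof.
move=> connA AU meetA; rewrite -setIidPl; apply: connA => //; first by exists (U i).
exists (~` \bigcup_(j in ~` [set i]) U j).
  by apply: open_closedC; apply: bigcup_open.
apply/seteqP; split=> z [Az]; [move=> Uz|move=> nUz]; split=> //.
  by case=> j /= ji Uj; apply: ji; apply: disjU => //; exists z.
have [j _ Uj] := AU z Az; have [<-//|/eqP ji] := eqVneq j i.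
by case: nUz; exists j.
Qed.
End OpenPartition.

Section FiniteFamily.
Variables (T : topologicalType) (I : finType) (C : I -> set T).

Lemma open_partition_reindex (U : I -> set T) :
  (forall i, C i !=set0) -> (forall i, connected (C i)) ->
  (forall i, open (U i)) -> trivIset setT U ->
  \bigcup_i C i `<=` \bigcup_i U i -> (forall i, (U i `&` \bigcup_j C j) !=set0) ->
  exists2 psi : I -> I, bijective psi & forall i, C (psi i) = U i `&` \bigcup_j C j.
Proof.
move=> C0 connC openU disjU CU meetU.
have CsubU i j : U i `&` C j !=set0 -> C j `<=` U i.
  move=> meet; apply: connected_sub_open_partition => //; last by rewrite setIC.
  by apply: subset_trans CU; apply: bigcup_sup.
have /choice[psi psiU] i : exists j, C j `<=` U i.
  by have [z [Uz [j _ Cz]]] := meetU i; exists j; apply: CsubU; exists z.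
have inj_psi : injective psi.
  move=> i j eq_psi; have [z Cz] := C0 (psi i).
  by apply: disjU => //; exists z; split; [exact: psiU|apply: psiU; rewrite -eq_psi].
have [phi psiK phiK] := injF_bij inj_psi.
exists psi; first by exists phi.
move=> i; apply/seteqP; split=> z; first by move=> Cz; split; [exact: psiU|exists (psi i)].
move=> [Uz [j _ Cz]]; suff -> : i = phi j by rewrite phiK.
by apply: disjU => //; exists z; split=> //; apply: psiU; rewrite phiK.
Qed.

Hypotheses (closedC : forall i, closed (C i)) (disjC : trivIset setT C).

Lemma near_closed_family i z : C i z -> \forall w \near z, forall j, C j w -> j = i.
Proof.
move=> Cz; apply: filter_forall => j; have [->|ji] := eqVneq j i; first by near=> w.
have : nbhs z (~` C j).
  apply: open_nbhs_nbhs; split; first exact: closed_openC.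
  by move=> Cjz; case/eqP: ji; apply: disjC => //; exists z.
by apply: filterS => w nCw /nCw.
Unshelve. all: by end_near. Qed.
End FiniteFamily.

Lemma near_ball_sub (R : realFieldType) (V : pseudoMetricType R) (x : V) (U : set V) :
  nbhs x U -> \forall y \near x & e \near 0^'+, ball y e `<=` U.
Proof.
move=> /nbhs_ballP[d /= d0 dU]; have d2 : 0 < d / 2 by rewrite divr_gt0.
near=> y e; have xy : ball x (d / 2) y by near: y; apply: nbhsx_ballx.
have ed : e <= d / 2 by apply: ltW; near: e; apply: nbhs_right_lt.
by move=> z /(le_ball ed) yz; apply: dU; rewrite [d]splitr; apply: ball_triangle yz.
Unshelve. all: by end_near. Qed.

Lemma compact_family_distance (R : realFieldType) (V : pseudoMetricType R) (I : finType)
    (C : I -> set V) :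
  (forall i, compact (C i)) -> (forall i, closed (C i)) -> trivIset setT C ->
  \forall e \near 0^'+, forall i j x y, C i x -> C j y -> ball x e y -> i = j.
Proof.
move=> compC closC disjC; apply: filter_forall => i.
have /compact_near_coveringP covC := compC i.
have near_i x : C i x -> \forall x' \near x & e \near 0^'+,
    ball x' e `<=` [set y | forall j, C j y -> j = i].
  by move=> Cx; apply/near_ball_sub/near_closed_family.
apply: filterS (covC _ _ (fun e x => ball x e `<=` _) _ near_i) => e sub_e j x y Cx Cy xy.
by rewrite (sub_e x Cx y xy j Cy).
Qed.

Lemma filter_forall_ltn (T : Type) (F : set_system T) (FF : Filter F) m (P : nat -> T -> Prop) :
  (forall i, (i < m)%N -> \forall x \near F, P i x) ->
  \forall x \near F, forall i, (i < m)%N -> P i x.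
Proof.
move=> PF; have : \forall x \near F, forall i : 'I_m, P i x.
  by apply: filter_forall => i; apply: PF.
by apply: filterS => x Px i im; apply: (Px (Ordinal im)).
Qed.

Lemma filter_all_pairs (T : Type) (F : set_system T) (FF : Filter F) m
    (P : T -> nat -> nat -> bool) :
  (forall i j, (i < m)%N -> (j < m)%N -> \forall x \near F, P x i j) ->
  \forall x \near F, all_pairs m (P x).
Proof.
move=> PF; have : \forall x \near F, forall i, (i < m)%N -> forall j, (j < m)%N -> P x i j.
  apply: filter_forall_ltn => i im; apply: filter_forall_ltn => j jm; exact: PF.
by apply: filterS => x Px; apply/all_pairsP => i j im jm; apply: Px.
Qed.

Lemma near_right0_div_natr (R : realType) (P : R -> Prop) (c : R) (M : nat) : 0 < c -> (0 < M)%N ->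
  (\forall e \near 0^'+, P e) -> \forall g \near \oo, P (c / (M * g.+1)%:R).
Proof.
move=> c0 M0 [d /= d0 dP]; have cM : 0 < c / M%:R by rewrite divr_gt0 ?ltr0n.
have := near_infty_natSinv_lt (PosNum (divr_gt0 d0 cM)); apply: filterS => g /=.
rewrite ltr_pdivlMr // mulrC natrM invfM mulrA => gd.
have cMg : 0 < c / M%:R / g.+1%:R by rewrite divr_gt0 ?ltr0n.
by apply: dP => //=; rewrite sub0r normrN gtr0_norm.
Qed.

(** * The sphere as a one-point compactification *)

Lemma nbhs_rat_itv (R : realType) (x : R) (A : set R) : nbhs x A ->
  exists a b : rat, [/\ a < b, ratr a < x, x < ratr b &
    forall y, ratr a < y -> y < ratr b -> A y].
Proof.
move=> /nbhs_ballP[e /= e0 eA].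
have /rat_in_itvoo[a] : x - e < x by rewrite ltrBlDr ltrDl.
have /rat_in_itvoo[b] : x < x + e by rewrite ltrDl.
rewrite !in_itv /= => /andP[xb bx] /andP[ax xa]; exists a, b; split=> //.
  by rewrite -(ltr_rat R); apply: lt_trans xb.
by move=> y ay yb; apply: eA; rewrite /ball /= ltr_norml; lra.
Qed.

Section Sphere.
Variable R : realType.
Local Notation plane := (R * R)%type.
Local Notation sphere := (one_point_compactification plane).
Implicit Types (b : basic) (S : set sphere) (z : sphere) (p : plane).

Lemma continuous_sum_sqr : continuous (fun p => p.1 ^+ 2 + p.2 ^+ 2).
Proof.
move=> p; rewrite (_ : (fun _ => _) = (fun p => p.1 * p.1 + p.2 * p.2)); last first.
  by apply/funext.
by apply: cvgD; apply: cvgM; (exact: cvg_fst || exact: cvg_snd).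
Qed.

Lemma compact_disk (r : R) : compact [set p : plane | p.1 ^+ 2 + p.2 ^+ 2 <= r].
Proof.
apply: (@subclosed_compact _ _ (`[- (r + 1), r + 1] `*` `[- (r + 1), r + 1])).
- apply: (@closed_comp _ _ (fun p => p.1 ^+ 2 + p.2 ^+ 2) [set x | x <= r]).
    by move=> p _; apply: continuous_sum_sqr.
  exact: closed_le.
- by apply: compact_setX; apply: segment_compact.
- by move=> [x y] /= xy; split; rewrite /= in_itv /=; apply/andP; split; nra.
Qed.

Lemma open_in_basic b : open (in_basic b : set sphere).
Proof.
rewrite openE => -[[x y]|].
  case: b => [[[a b] [c d]] [ax [xb [cy yd]]]|r xy].
    have nbhs_xy : nbhs (x, y) (`]ratr a, ratr b[ `*` `]ratr c, ratr d[ : set plane).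
      exists (`]ratr a, ratr b[%classic, `]ratr c, ratr d[%classic) => //.
      by split; apply: open_nbhs_nbhs; split; rewrite ?interval_open //= in_itv /= ?ax ?cy.
    by apply: filterS nbhs_xy => -[x' y'] [] /=; rewrite !in_itv /= => /andP[? ?] /andP[].
  have nbhs_xy : nbhs (x, y) [set p : plane | ratr r ^+ 2 < p.1 ^+ 2 + p.2 ^+ 2].
    apply: (@continuous_sum_sqr (x, y) [set s | ratr r ^+ 2 < s]).
    by apply: open_nbhs_nbhs; split; [exact: open_gt|exact: xy].
  by apply: filterS nbhs_xy => -[].
case: b => [[[a b] [c d]] //|r _]; exists [set p | p.1 ^+ 2 + p.2 ^+ 2 <= ratr r ^+ 2].
  have compD := @compact_disk (ratr r ^+ 2); split=> //.
  by apply: compact_closed compD; exact: norm_hausdorff.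
by move=> z [[[x y] /= /negP]|->] //; rewrite -ltNge => xy <-.
Qed.

Lemma open_preimage_some (U : set sphere) : open U -> open (Some @^-1` U : set plane).
Proof.
by apply: open_comp => p _; apply: one_point_compactification_some_continuous.
Qed.

Lemma closed_preimage_some (F : set sphere) : closed F -> closed (Some @^-1` F : set plane).
Proof.
by apply: closed_comp => p _; apply: one_point_compactification_some_continuous.
Qed.

Lemma in_basic_sub_cl b z : in_basic b z -> in_basic_cl b z.
Proof.
case: b z => [[[a b] [c d]]|r] [[x y]|] //=; last exact: ltW.
by move=> [? [? [? ?]]]; rewrite !ltW.
Qed.

Lemma closed_in_basic_cl b : closed [set p : plane | in_basic_cl b (Some p)].
Proof.
case: b => [[[a b] [c d]]|r].
  rewrite (_ : mkset _ = `[ratr a, ratr b] `*` `[ratr c, ratr d]).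
    apply: compact_closed; first exact: norm_hausdorff.
    by apply: compact_setX; apply: segment_compact.
  apply/seteqP; split=> -[x y] /=; rewrite !in_itv /=; first by move=> [-> [-> [-> ->]]].
  by move=> [/andP[? ?] /andP[? ?]].
rewrite (_ : mkset _ = (fun p => p.1 ^+ 2 + p.2 ^+ 2) @^-1` [set s | ratr r ^+ 2 <= s]).
  by apply: closed_comp (@closed_ge _ _) => p _; apply: continuous_sum_sqr.
by apply/seteqP; split=> -[].
Qed.

Lemma nbhs_basicP z (U : set sphere) :
  nbhs z U <-> exists b, [/\ basic_valid b, in_basic b z & forall w, in_basic b w -> U w].
Proof.
split=> [|[b [_ bz bU]]]; last first.
  by apply: filterS bU _; apply: open_nbhs_nbhs; split; [exact: open_in_basic|].
case: z => [[x y]|].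
  move=> [[A B] /= [/nbhs_rat_itv[a [b [ab ax xb abA]]] /nbhs_rat_itv[c [d [cd cy yd cdB]]]] AB].
  exists (inl ((a, b), (c, d))); split=> // -[[x' y']|] //= [ax' [xb' [cy' yd']]].
  by apply: (AB (x', y')); split; [exact: abA|exact: cdB].
move=> [W [/compact_bounded[M [_ MW]] _] WU].
have [N MN] : exists N : nat, M < N.+1%:R.
  by exists (Num.truncn `|M|); apply: le_lt_trans (ler_norm M) (truncnS_gt _).
exists (inr (2 * N.+1)%:R); split=> [|//|]; first by rewrite /= ltr0n.
case=> [[x y] /=|_]; last by apply: WU; right.
rewrite ratr_nat natrM => xy; apply: WU; left.
exists (x, y) => // /(MW _ MN); rewrite /= /Num.norm /= ge_max !ler_norml /=.
move=> /andP[/andP[? ?] /andP[? ?]]; have N0 : 0 <= N.+1%:R :> R by [].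
by move: xy; apply/negP; rewrite -leNgt; nra.
Qed.
Lemma copenP S : copen S <-> open S.
Proof.
rewrite openE; split=> openS z /openS; last first.
  by move=> /nbhs_basicP[b [vb bz bS]]; exists b.
by move=> [b [vb [bz bS]]]; apply/nbhs_basicP; exists b.
Qed.

Lemma cclosureE S : cclosure S = closure S.
Proof.
apply/seteqP; split=> z clz.
  by move=> B /nbhs_basicP[b [vb bz bB]]; have [w [/bB]] := clz b vb bz; exists w.
move=> b vb bz; have nbhs_b : nbhs (z : sphere) (in_basic b).
  by apply: open_nbhs_nbhs; split; [exact: open_in_basic|].
by have [w []] := clz _ nbhs_b; exists w.
Qed.

Lemma cinteriorE S : cinterior S = S°.
Proof.
apply/seteqP; split=> z; first by move=> [b [vb [bz bS]]]; apply/nbhs_basicP; exists b.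
by move=> /nbhs_basicP[b [vb bz bS]]; exists b.
Qed.

Lemma cboundaryE S : cboundary S = closure S `&` ~` S°.
Proof. by rewrite -cclosureE -cinteriorE. Qed.

Lemma cconnectedP S : cconnected S <-> connected S.
Proof.
split=> [connS B [z Bz] [U openU BSU] [F closF BSF]|connS].
  apply: contrapT => BS; apply: connS; exists U, (~` F).
  have [w [Sw Fw]] : exists w, S w /\ ~ F w.
    apply: contrapT => nw; apply: BS; rewrite BSF; apply/setIidPl => w Sw.
    by apply: contrapT => Fw; apply: nw; exists w.
  split; first exact/copenP; split; first exact/copenP/closed_openC.
  split=> [v Sv|].
    have [Fv|] := pselect (F v); last by right.
    by left; have [] : (S `&` U) v by rewrite -BSU BSF.
  split; first by move: Bz; rewrite BSU => -[Sz Uz]; exists z.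
  split; first by exists w.
  move=> v [Sv [Uv nFv]]; have : B v by rewrite BSU.
  by rewrite BSF => -[].
move=> [U [V [/copenP openU [/copenP openV [SUV [[u [Su Uu]] [[v [Sv Vv]] SUV0]]]]]]].
have SU : S `&` U = S.
  apply: connS; [by exists u|by exists U|exists (~` V); first exact: open_closedC].
  apply/seteqP; split=> w [Sw]; first by move=> Uw; split=> // Vw; case: (SUV0 w).
  by move=> nVw; split=> //; case: (SUV w Sw).
by apply: (SUV0 v); split=> //; move: Sv; rewrite -{1}SU => -[].
Qed.

Lemma ccomponent_ofE S z : ccomponent_of S z = connected_component S z.
Proof.
apply/seteqP; split=> w.
  by move=> [T [/cconnectedP connT [TS [Tz Tw]]]]; exists T.
by move=> [T [Tz TS /cconnectedP connT] Tw]; exists T.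
Qed.

(* The sphere is the union of the closures of the horizontal lines, which are connected
   and contain the point at infinity. *)
Lemma connected_sphere : connected [set: sphere].
Proof.
pose line (p : plane) (s : R) : sphere := Some (p.1 + s, p.2).
have line_inf p : closure (range (line p)) None.
  rewrite -cclosureE => -[[[a b] [c d]] //|r] r0 _; exists (line p (`|p.1| + ratr r + 1)).
  split; last by eexists.
  rewrite /= in r0; have {}r0 : 0 < ratr r :> R by rewrite ltr0q.
  by have := sqr_ge0 p.2; have := ler_norm (- p.1); rewrite normrN /=; nra.
have -> : [set: sphere] = \bigcup_p closure (range (line p)).
  apply/seteqP; split=> // -[p|] _; [exists p|exists 0] => //.
  apply: subset_closure; exists 0 => //; rewrite /line addr0; by case: p.
apply: bigcup_connected => [|p _]; first by exists None => p _.
apply: connected_closure; apply: connected_continuous_connected.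
  by apply/connected_intervalP => ? ? ? ? ?.
apply: continuous_subspaceT => s.
apply: (@continuous_comp _ _ _ (fun s => (p.1 + s, p.2)) (Some : plane -> sphere)).
  apply: (@cvg_pair _ _ _ (nbhs s) (nbhs (p.1 + s)) (nbhs p.2)); last exact: cvg_cst.
  by apply: cvgD; [exact: cvg_cst|exact: cvg_id].
exact: one_point_compactification_some_continuous.
Qed.
End Sphere.

(** * Comparing basic open sets with rational squares *)

Definition square (x y h : rat) : basic := inl ((x - h, x + h), (y - h, y + h)).

(* On [[x - h, x + h]] the absolute value has minimum [Num.max 0 (`|x| - h)] and
   maximum [`|x| + h]. *)
Definition contains_square (b : basic) (x y h : rat) : bool :=
  match b with
  | inl ((x0, x1), (y0, y1)) => [&& x0 <= x - h, x + h <= x1, y0 <= y - h & y + h <= y1]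
  | inr r => r ^+ 2 < Num.max 0 (`|x| - h) ^+ 2 + Num.max 0 (`|y| - h) ^+ 2
  end.

Definition avoids_square (b : basic) (x y h : rat) : bool :=
  match b with
  | inl ((x0, x1), (y0, y1)) => [|| x + h <= x0, x1 <= x - h, y + h <= y0 | y1 <= y - h]
  | inr r => (`|x| + h) ^+ 2 + (`|y| + h) ^+ 2 <= r ^+ 2
  end.

Section NormAttained.
Variable F : realFieldType.
Implicit Types x h : F.

Lemma dist_addr_le x h : 0 <= h -> `|x - (x + h)| <= h.
Proof. by move=> h0; rewrite opprD addNKr normrN ger0_norm. Qed.

Lemma dist_subr_le x h : 0 <= h -> `|x - (x - h)| <= h.
Proof. by move=> h0; rewrite subKr ger0_norm. Qed.

Lemma min_norm_attained x h : 0 <= h ->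
  exists2 s, `|x - s| <= h & `|s| = Num.max 0 (`|x| - h).
Proof.
move=> h0; have [xh|] := leP `|x| h.
  by exists 0; rewrite ?subr0 // normr0 max_l // subr_le0.
move=> hx; rewrite max_r ?subr_ge0 ?(ltW hx) //; move: hx; have [x0|x0] := ler0P x => hx.
  by exists (x + h); [exact: dist_addr_le|rewrite ler0_norm; lra].
by exists (x - h); [exact: dist_subr_le|rewrite ger0_norm; lra].
Qed.

Lemma max_norm_attained x h : 0 <= h -> exists2 s, `|x - s| <= h & `|s| = `|x| + h.
Proof.
move=> h0; have [x0|x0] := ler0P x.
  by exists (x - h); [exact: dist_subr_le|rewrite ler0_norm; lra].
by exists (x + h); [exact: dist_addr_le|rewrite ger0_norm; lra].
Qed.
End NormAttained.

Section Squares.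
Variable R : realType.
Local Notation plane := (R * R)%type.
Implicit Types (x y h : rat) (b : basic) (p : plane) (z : Chat R).

Lemma in_square x y h p :
  in_basic (square x y h) (Some p) <-> ball ((ratr x, ratr y) : plane) (ratr h) p.
Proof.
case: p => s t; rewrite -[ball _ _ _]/(`|ratr x - s| < ratr h /\ `|ratr y - t| < ratr h).
rewrite /= !rmorphD !rmorphN !ltr_norml; split.
  by move=> [? [? [? ?]]]; split; lra.
by move=> [/andP[? ?] /andP[? ?]]; do !split; lra.
Qed.

Lemma in_square_cl x y h p : in_basic_cl (square x y h) (Some p) <->
  `|ratr x - p.1| <= ratr h /\ `|ratr y - p.2| <= ratr h.
Proof.
case: p => s t; rewrite /= !rmorphD !rmorphN !ler_norml; split.
  by move=> [? [? [? ?]]]; split; lra.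
by move=> [/andP[? ?] /andP[? ?]]; do !split; lra.
Qed.

Lemma contains_square_sound b x y h z :
  contains_square b x y h -> in_basic (square x y h) z -> in_basic b z.
Proof.
case: z => [[s t]|] //; case: b => [[[x0 x1] [y0 y1]]|r].
  move=> /and4P[]; rewrite -!(ler_rat R) => x0x xx1 y0y yy1 [xs [sx [yt ty]]].
  split; first exact: le_lt_trans xs.
  split; first exact: lt_le_trans xx1.
  by split; [exact: le_lt_trans yt|exact: lt_le_trans yy1].
have norm_ge u v : `|ratr u - v| < ratr h -> ratr (Num.max 0 (`|u| - h) ^+ 2) <= v ^+ 2 :> R.
  move=> uv; rewrite rmorphXn -[v ^+ 2]real_normK ?num_real // ler_sqr ?nnegrE ?normr_ge0 //.
    rewrite /Num.max; case: ifP => _; last by rewrite rmorph0.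
    by rewrite rmorphB /= ratr_norm; have := ler_normD (ratr u - v) v; rewrite subrK; lra.
  by rewrite ler0q le_max lexx.
rewrite /contains_square -(ltr_rat R) rmorphXn rmorphD => rxy.
move=> /in_square[/norm_ge sx /norm_ge ty].
by apply: lt_le_trans rxy _; apply: lerD.
Qed.

Lemma avoids_square_sound b x y h z :
  avoids_square b x y h -> in_basic (square x y h) z -> ~ in_basic_cl b z.
Proof.
case: z => [[s t]|] //; case: b => [[[x0 x1] [y0 y1]]|r].
  rewrite /= -!(ler_rat R) => avoid [xs [sx [yt ty]]] [x0s [sx1 [y0t ty1]]].
  by case/or4P: avoid; lra.
have norm_lt u v : `|ratr u - v| < ratr h -> v ^+ 2 < ratr ((`|u| + h) ^+ 2) :> R.
  move=> uv; have vu : `|v| < ratr (`|u| + h) :> R.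
    by rewrite rmorphD /= ratr_norm; have := ler_normB (ratr u) (ratr u - v); rewrite subKr; lra.
  rewrite rmorphXn -[v ^+ 2]real_normK ?num_real // ltr_sqr ?nnegrE ?normr_ge0 //.
  exact: le_trans (normr_ge0 _) (ltW vu).
rewrite /avoids_square -(ler_rat R) rmorphXn rmorphD => xyr /in_square[/norm_lt sx /norm_lt ty].
by apply/negP; rewrite -ltNge; apply: lt_le_trans xyr; apply: ltrD.
Qed.

Lemma in_square_cl_rat x y h s t : `|x - s| <= h -> `|y - t| <= h ->
  in_basic_cl (square x y h) (Some (ratr s, ratr t) : Chat R).
Proof. by move=> xs yt; apply/in_square_cl; rewrite /= -!rmorphB -!ratr_norm !ler_rat. Qed.

Lemma contains_square_complete b x y h : 0 <= h ->
  (forall z : Chat R, in_basic_cl (square x y h) z -> in_basic b z) ->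
  contains_square b x y h.
Proof.
move=> h0 sub; case: b sub => [[[x0 x1] [y0 y1]]|r] sub /=.
  have [/ltW ? [_ [/ltW ? _]]] := sub _ (in_square_cl_rat (dist_subr_le x h0) (dist_subr_le y h0)).
  have [_ [/ltW ? [_ /ltW ?]]] := sub _ (in_square_cl_rat (dist_addr_le x h0) (dist_addr_le y h0)).
  by rewrite -!(ler_rat R); apply/and4P.
have [[s xs sE] [t yt tE]] := (min_norm_attained x h0, min_norm_attained y h0).
move: (sub _ (in_square_cl_rat xs yt)) => /=.
by rewrite -sE -tE !real_normK ?num_real // -!rmorphXn -rmorphD ltr_rat.
Qed.

Lemma avoids_square_complete b x y h : basic_valid b -> 0 <= h ->
  (forall z : Chat R, in_basic_cl (square x y h) z -> ~ in_basic_cl b z) ->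
  avoids_square b x y h.
Proof.
case: b => [[[x0 x1] [y0 y1]]|r] vb h0 disj; last first.
  have [[s xs sE] [t yt tE]] := (max_norm_attained x h0, max_norm_attained y h0).
  move/negP: (disj _ (in_square_cl_rat xs yt)).
  rewrite /= -!rmorphXn -rmorphD ler_rat -ltNge => /ltW.
  by rewrite -sE -tE !real_normK ?num_real.
have clip u v0 v1 : v0 < v1 -> v0 < u + h -> u - h < v1 ->
    exists2 s, `|u - s| <= h & v0 <= s <= v1.
  move=> v01 v0u uv1; exists (Num.max v0 (u - h)); last first.
    by rewrite le_max lexx ge_max (ltW v01) (ltW uv1).
  by rewrite ler_norml /Num.max; case: ifP => ?; apply/andP; split; lra.
case: vb => x01 y01; apply/negPn/negP.
rewrite !negb_or -!ltNge => /and4P[x0x xx1 y0y yy1].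
have [s xs /andP[x0s sx1]] := clip _ _ _ x01 x0x xx1.
have [t yt /andP[y0t ty1]] := clip _ _ _ y01 y0y yy1.
by apply: disj (in_square_cl_rat xs yt) _; rewrite /= !ler_rat.
Qed.
End Squares.

(** * Grids *)

(* The grid of mesh [1 / M] on [[- B, B]] has the indices [i < grid_size B M]. *)
Definition grid (F : unitRingType) (B M i : nat) : F := i%:R / M%:R - B%:R.
Definition grid_size (B M : nat) : nat := (2 * (B * M)).+1.

Definition adjacent (i i' : nat) : bool := ((i <= i'.+1) && (i' <= i.+1))%N.

Lemma ratr_grid (R : realType) B M i : ratr (grid rat B M i) = grid R B M i.
Proof. by rewrite /grid rmorphB fmorph_div !rmorph_nat. Qed.

Lemma refined_index_lt B M g i :
  (i < grid_size B (M * g.+1))%N -> (i %/ g.+1 < grid_size B M)%N.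
Proof. by rewrite ltn_divLR // /grid_size; nia. Qed.

Section Grid.
Variables (R : realType) (B M : nat).
Hypothesis M_gt0 : (0 < M)%N.
Implicit Types s t : R.
Local Notation grid := (grid R).

Let MR_gt0 : 0 < M%:R :> R. Proof. by rewrite ltr0n. Qed.

Lemma dist_gridE i s c : (`|grid B M i - s| < c / M%:R) =
  (`|i%:R - (s + B%:R) * M%:R| < c).
Proof.
rewrite ltr_pdivlMr // -[X in `|_| * X](gtr0_norm MR_gt0) -normrM; congr (`|_| < _).
by rewrite /grid; field; rewrite gt_eqF.
Qed.

Lemma grid_cover s : `|s| <= B%:R ->
  exists2 i, (i < grid_size B M)%N & `|grid B M i - s| < M%:R^-1.
Proof.
rewrite ler_norml => /andP[Bs sB]; set u := (s + B%:R) * M%:R.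
have u0 : 0 <= u by rewrite mulr_ge0 //; lra.
have /andP[iu ui] := truncn_itv u0; exists (Num.truncn u).
  rewrite ltnS -(ler_nat R) (le_trans iu) // !natrM mulrA ler_pM2r //; lra.
by rewrite -[_^-1]mul1r dist_gridE -/u ltr_norml; move: ui; rewrite -natr1 => ui; lra.
Qed.

Lemma grid_adjacent i i' s :
  `|grid B M i - s| < M%:R^-1 -> `|grid B M i' - s| < M%:R^-1 -> adjacent i i'.
Proof.
rewrite -[_^-1]mul1r !dist_gridE !ltr_norml => /andP[? ?] /andP[? ?].
by apply/andP; split; rewrite -ltnS -(ltr_nat R) -!natr1; lra.
Qed.

Lemma grid_dist i i' s t : adjacent i i' ->
  `|grid B M i - s| < 2 / M%:R -> `|grid B M i' - t| < 2 / M%:R -> `|s - t| < 5 / M%:R.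
Proof.
move=> /andP[ii' i'i]; rewrite -(ler_nat R) -natr1 in ii'; rewrite -(ler_nat R) -natr1 in i'i.
have -> : (`|s - t| < 5 / M%:R) = (`|(s + B%:R) * M%:R - (t + B%:R) * M%:R| < 5).
  rewrite ltr_pdivlMr // -[X in `|_| * X](gtr0_norm MR_gt0) -normrM; congr (`|_| < _); ring.
by rewrite !dist_gridE !ltr_norml => /andP[? ?] /andP[? ?]; lra.
Qed.

Lemma grid_box i : (i < grid_size B M)%N -> `|grid B M i| <= B%:R.
Proof.
rewrite ltnS -(ler_nat R) !natrM => iBM; rewrite /grid ler_distl subrr divr_ge0 //=.
by rewrite ler_pdivrMr //; lra.
Qed.
End Grid.

Lemma grid_refine (R : realType) B M g i (s : R) : (0 < M)%N ->
  `|grid R B (M * g.+1) i - s| < (M * g.+1)%:R^-1 ->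
  `|grid R B M (i %/ g.+1) - s| < M%:R^-1.
Proof.
move=> M0; rewrite -[_^-1]mul1r -[X in _ -> _ < X]mul1r !dist_gridE ?muln_gt0 ?M0 //.
have rem_lt : (i %% g.+1)%:R + 1 <= g.+1%:R :> R by rewrite natr1 ler_nat ltn_pmod.
rewrite {1}(divn_eq i g.+1) natrM natrD natrM.
have rem_ge0 : 0 <= (i %% g.+1)%:R :> R by [].
have G0 : 0 < g.+1%:R :> R by [].
rewrite -[X in _ -> is_true X](ltr_pM2r G0) mul1r -[X in `|_| * X](gtr0_norm G0) -normrM.
set q := (i %/ g.+1)%:R; set r := (i %% g.+1)%:R in rem_lt rem_ge0 *.
set G := g.+1%:R in G0 rem_lt *.
have -> : (q - (s + B%:R) * M%:R) * G = q * G + r - (s + B%:R) * (M%:R * G) - r by ring.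
rewrite !ltr_norml; lra.
Qed.

Definition cell (B M i j : nat) : basic :=
  square (grid rat B M i) (grid rat B M j) M%:R^-1.

Lemma cell_valid B M i j : (0 < M)%N -> basic_valid (cell B M i j).
Proof.
move=> M0; have : 0 < M%:R^-1 :> rat by rewrite invr_gt0 ltr0n.
by rewrite /=; lra.
Qed.

Section Cells.
Variables (R : realType) (B M : nat).
Hypothesis M_gt0 : (0 < M)%N.
Local Notation plane := (R * R)%type.
Implicit Types (p q : plane) (z : Chat R).

Definition cell_center (i j : nat) : plane := (grid R B M i, grid R B M j).

Lemma in_cell i j p :
  in_basic (cell B M i j) (Some p) <-> ball (cell_center i j) M%:R^-1 p.
Proof. by rewrite in_square fmorphV /= !ratr_grid ratr_nat. Qed.

Lemma in_cell_center i j : in_basic (cell B M i j) (Some (cell_center i j)).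
Proof. by apply/in_cell; apply: ballxx; rewrite invr_gt0 ltr0n. Qed.

Lemma in_cell_cl_ball i j p :
  in_basic_cl (cell B M i j) (Some p) -> ball (cell_center i j) (2 / M%:R) p.
Proof.
move=> /in_square_cl; rewrite fmorphV /= !ratr_grid ratr_nat => -[ip jp].
have M1 : M%:R^-1 < 2 / M%:R :> R.
  by rewrite -[ltLHS]mul1r ltr_pM2r ?invr_gt0 ?ltr0n // ltr1n.
by split; [exact: le_lt_trans ip M1|exact: le_lt_trans jp M1].
Qed.

Lemma cell_cover p : `|p.1| <= B%:R -> `|p.2| <= B%:R -> exists i j,
  [/\ (i < grid_size B M)%N, (j < grid_size B M)%N & in_basic (cell B M i j) (Some p)].
Proof.
move=> /(grid_cover M_gt0)[i iB ip] /(grid_cover M_gt0)[j jB jp].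
by exists i, j; split=> //; apply/in_cell.
Qed.

Lemma cell_adjacent i j i' j' z :
  in_basic (cell B M i j) z -> in_basic (cell B M i' j') z -> adjacent i i' /\ adjacent j j'.
Proof.
case: z => [p|] // /in_cell[ip jp] /in_cell[ip' jp'].
by split; [exact: grid_adjacent ip ip'|exact: grid_adjacent jp jp'].
Qed.

Lemma cell_refine g i j z : in_basic (cell B (M * g.+1) i j) z ->
  in_basic (cell B M (i %/ g.+1) (j %/ g.+1)) z.
Proof.
case: z => [p|] //; rewrite in_square !fmorphV /= !ratr_grid !ratr_nat => -[ip jp].
by apply/in_cell; split; apply: grid_refine.
Qed.

Lemma adjacent_cells_ball i j i' j' p q : adjacent i i' -> adjacent j j' ->
  in_basic_cl (cell B M i j) (Some p) -> in_basic_cl (cell B M i' j') (Some q) ->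
  ball p (5 / M%:R) q.
Proof.
move=> ii' jj' /in_cell_cl_ball[ip jp] /in_cell_cl_ball[iq jq].
by split; [exact: grid_dist ii' ip iq|exact: grid_dist jj' jp jq].
Qed.
End Cells.

(** * The components of the complement of a domain *)

Section Complement.
Variable R : realType.
Local Notation plane := (R * R)%type.
Local Notation sphere := (one_point_compactification plane).
Implicit Types (z : sphere) (p q : plane).

Definition box (B : nat) : set plane := [set p | `|p.1| <= B%:R /\ `|p.2| <= B%:R].

Lemma compact_box B : compact (box B).
Proof.
have -> : box B = `[- B%:R, B%:R] `*` `[- B%:R, B%:R].
  by apply/seteqP; split=> -[x y] [] /=; rewrite !in_itv /= -!ler_norml.
by apply: compact_setX; apply: segment_compact.
Qed.

Variable D : set sphere.

Lemma compl_sub_box B p :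
  (forall z, in_basic_cl (inr B%:R) z -> D z) -> ~ D (Some p) -> box B p.
Proof.
case: p => x y extD Kxy; have xyB : x ^+ 2 + y ^+ 2 < B%:R ^+ 2.
  by rewrite ltNge; apply/negP => h; apply/Kxy/extD => /=; rewrite ratr_nat.
split=> /=; rewrite -ler_sqr ?nnegrE // real_normK ?num_real //.
  by have := sqr_ge0 y; lra.
by have := sqr_ge0 x; lra.
Qed.

Hypothesis openD : open D.

Lemma exterior_sub_domain : D None ->
  exists2 B, (0 < B)%N & forall z, in_basic_cl (inr B%:R) z -> D z.
Proof.
move=> Dinf; have /nbhs_basicP[b [vb bz bD]] : nbhs (None : sphere) D by exact: open_nbhs_nbhs.
case: b vb bz bD => [[[? ?] [? ?]] //|r] /= r0 _ rD.
exists (Num.truncn r).+1 => // z rz; apply: rD; case: z rz => [[x y]|] //.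
apply: lt_le_trans; rewrite ltr_sqr ?nnegrE ?ler0q ?ler0n // ?ltW //.
by rewrite ltr_rat truncnS_gt.
Qed.

Lemma cboundary_open : cboundary D = closure D `&` ~` D.
Proof. by rewrite cboundaryE ((interior_id _).1 openD). Qed.

Variables (n : nat) (C : 'I_n -> set sphere).
Hypothesis labC : component_labeling (ccompl D) C.

Lemma labeling_component l : exists2 z, ~ D z & C l = connected_component (~` D) z.
Proof.
have [/(_ l)[z [Dz Cz]] _] := labC; exists z => //.
by rewrite -ccomponent_ofE; apply/seteqP; split=> w /Cz.
Qed.

Lemma labeling_connected l : connected (C l).
Proof. by have [z _ ->] := labeling_component l; apply: component_connected. Qed.

Lemma labeling_neq0 l : C l !=set0.
Proof.
by have [z Dz ->] := labeling_component l; exists z; apply: connected_component_refl.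
Qed.

Lemma labeling_closed l : closed (C l).
Proof.
by have [z _ ->] := labeling_component l; apply/component_closed/open_closedC.
Qed.

Lemma labeling_bigcup : \bigcup_l C l = ~` D.
Proof.
apply/seteqP; split=> z.
  by move=> [l _]; have [w _ ->] := labeling_component l => /connected_component_sub.
have [_ [_ /(_ (ccomponent_of (ccompl D) z))]] := labC => surj Dz.
have [|l Cl] := surj; first by exists z.
exists l => //; apply/Cl; rewrite ccomponent_ofE; exact: connected_component_refl.
Qed.

Lemma labeling_sub l z : C l z -> ~ D z.
Proof. by move=> Cz; have : (~` D) z by rewrite -labeling_bigcup; exists l. Qed.

Lemma labeling_cover z : ~ D z -> exists l, C l z.
Proof.
move=> Dz; have [l _ Cz] : (\bigcup_l C l) z by rewrite labeling_bigcup.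
by exists l.
Qed.

Lemma labeling_trivIset : trivIset setT C.
Proof.
move=> l l' _ _ [z [Cz Cz']]; have [_ [inj _]] := labC; apply: inj => w.
move: Cz Cz'; have [u _ ->] := labeling_component l; have [v _ ->] := labeling_component l'.
by move=> /same_connected_component -> /same_connected_component ->.
Qed.

Lemma near_labeling l z : C l z -> \forall w \near z, ~ D w -> C l w.
Proof.
move=> Cz; have := near_closed_family labeling_closed labeling_trivIset Cz.
by apply: filterS => w Cw_l /labeling_cover[j Cw]; rewrite -(Cw_l j).
Qed.

Lemma cboundary_labeling l : cboundary (C l) = C l `&` closure D.
Proof.
rewrite cboundaryE -((closure_id _).1 (@labeling_closed l)) -[D in RHS]setCK closure_setC.
apply/seteqP; split=> z [Cz nint]; split=> // zint; apply: nint.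
  by apply: filterS2 zint (near_labeling Cz) => w Dw; apply.
by apply: filterS zint; apply: labeling_sub.
Qed.

Hypothesis Dinf : D None.

Lemma compl_finite z : ~ D z -> exists p, z = Some p.
Proof. by case: z => [p|//] _; exists p. Qed.

(* The sphere is connected, so a component of the complement cannot be open. *)
Lemma labeling_meets_closure l : exists p, C l (Some p) /\ closure D (Some p).
Proof.
have : cboundary (C l) !=set0.
  rewrite cboundaryE -((closure_id _).1 (@labeling_closed l)).
  apply: contrapT => bd0; have openC : open (C l).
    by rewrite openE => z Cz; apply: contrapT => nint; apply: bd0; exists z.
  have CT : C l = [set: sphere].
    apply: connected_sphere; first exact: labeling_neq0.
      by exists (C l); rewrite ?setTI.
    by exists (C l); rewrite ?setTI //; apply: labeling_closed.
  by apply: (@labeling_sub l None) => //; rewrite CT.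
rewrite cboundary_labeling => -[z [Cz clDz]].
by have [p zE] := compl_finite (labeling_sub Cz); exists p; rewrite -zE.
Qed.

Lemma labeling_distance : \forall e \near 0^'+, forall l l' p q,
  C l (Some p) -> C l' (Some q) -> ball p e q -> l = l'.
Proof.
have closedC l := closed_preimage_some (@labeling_closed l).
apply: (@compact_family_distance _ _ _ (fun l => Some @^-1` C l)) => //.
  move=> l; have [B _ extD] := exterior_sub_domain Dinf.
  apply: (@subclosed_compact _ _ (box B)) => [||p Cp]; first exact: closedC.
    exact: compact_box.
  exact: compl_sub_box extD (labeling_sub Cp).
by move=> l l' _ _ [p [Cp Cp']]; apply: labeling_trivIset => //; exists (Some p).
Qed.
End Complement.

(** * The algorithm *)

Section Algorithm.
Local Open Scope nat_scope.
Implicit Types (n t B M l g s : nat) (p : nat -> nat) (lab : nat -> nat -> nat) (b : basic).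

Definition basic_validb b : bool :=
  match b with
  | inl ((x0, x1), (y0, y1)) => (x0 < x1)%R && (y0 < y1)%R
  | inr r => (0 < r)%R
  end.

Lemma basic_validP b : reflect (basic_valid b) (basic_validb b).
Proof. by case: b => [[[a b] [c d]]|r]; [apply: andP|apply: idP]. Qed.

Definition listed p s b : bool := has (fun k => p k == (pickle b).+1) (iota 0 s).

Definition coherent B M lab : bool :=
  all_pairs (grid_size B M) (fun i j => all_pairs (grid_size B M) (fun i' j' =>
    [|| lab i j == 0, lab i' j' == 0, ~~ adjacent i i', ~~ adjacent j j'
      | lab i j == lab i' j'])).

Lemma coherentP B M lab : reflect
  (forall i j i' j', i < grid_size B M -> j < grid_size B M ->
     i' < grid_size B M -> j' < grid_size B M -> adjacent i i' -> adjacent j j' ->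
     lab i j != 0 -> lab i' j' != 0 -> lab i j = lab i' j')
  (coherent B M lab).
Proof.
apply: (iffP (all_pairsP _ _)) => [coh i j i' j' iB jB iB' jB' ii' jj' l0 l0'|coh i j iB jB].
  have /all_pairsP/(_ i' j' iB' jB') := coh i j iB jB.
  by rewrite (negbTE l0) (negbTE l0') ii' jj' => /eqP.
apply/all_pairsP => i' j' iB' jB'; have [//|l0] := eqVneq (lab i j) 0.
have [|l0'] := eqVneq (lab i' j') 0; first by rewrite orbT.
case: (boolP (adjacent i i')) => //= ii'; case: (boolP (adjacent j j')) => //= jj'.
by rewrite (coh i j i' j') ?eqxx.
Qed.

(* The label [0] marks a square whose closure lies in the domain, the label [l.+1] a
   square that may meet only the component of number [l]. *)
Definition separation_test n B M lab s p1 p2 : bool :=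
  [&& listed p1 s (inr B%:R%R),
      all_pairs (grid_size B M) (fun i j => (lab i j != 0) || listed p1 s (cell B M i j)),
      coherent B M lab &
      all (fun l => has_pair (grid_size B M) (fun i j =>
        (lab i j == l.+1) && listed p2 s (cell B M i j))) (iota 0 n)].

Definition open_test B M lab l b g s p : bool :=
  basic_validb b && all_pairs (grid_size B (M * g.+1)) (fun i j =>
    [|| lab (i %/ g.+1) (j %/ g.+1) != l.+1,
        avoids_square b (grid rat B (M * g.+1) i) (grid rat B (M * g.+1) j)
          ((M * g.+1)%:R^-1)%R
      | listed p s (cell B (M * g.+1) i j)]).

Definition boundary_test B M lab l b g s p : bool :=
  basic_validb b && has_pair (grid_size B (M * g.+1)) (fun i j =>
    [&& lab (i %/ g.+1) (j %/ g.+1) == l.+1,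
        contains_square b (grid rat B (M * g.+1) i) (grid rat B (M * g.+1) j)
          ((M * g.+1)%:R^-1)%R
      & listed p s (cell B (M * g.+1) i j)]).

Definition box_radius t : nat := unpair1 t.
Definition mesh t : nat := (unpair1 (unpair2 t)).+1.
Definition labels t : nat := unpair1 (unpair2 (unpair2 t)).
Definition stage t : nat := unpair2 (unpair2 (unpair2 t)).

(* Reducing modulo [n.+1] makes every [t] code a labelling by [0, ..., n]. *)
Definition label n t i j : nat :=
  word_nth (labels t) (i * grid_size (box_radius t) (mesh t) + j) %% n.+1.

Definition separation n t : (nat -> nat) -> (nat -> nat) -> bool :=
  separation_test n (box_radius t) (mesh t) (label n t) (stage t).

Definition enumeration (test : basic -> nat -> nat -> bool) (j : nat) : nat :=
  let b := basic_of_code (unpair1 j) in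
  if test b (unpair1 (unpair2 j)) (unpair2 (unpair2 j)) then (pickle b).+1 else 0.

(* The index [k] codes the number of a stream, a basic set, a refinement [g] of the grid
   and the length [s] of the prefixes to be consulted. *)
Definition output n t k p1 p2 : nat :=
  enumeration (fun b g s =>
    if unpair1 k %% 2 == 0
    then open_test (box_radius t) (mesh t) (label n t) (unpair1 k %/ 2) b g s p1
    else boundary_test (box_radius t) (mesh t) (label n t) (unpair1 k %/ 2) b g s p2)
    (unpair2 k).

Definition output_use k : nat := unpair2 (unpair2 (unpair2 k)).

Lemma listed_agree p p' s b : agree s p p' -> listed p s b = listed p' s b.
Proof. by move=> pp'; apply: eq_in_has => k; rewrite mem_iota => /andP[_ /pp' ->]. Qed.

Lemma separation_reads n t : reads t (separation n t).
Proof.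
have stage_le : stage t <= t by rewrite /stage !(leq_trans (leq_unpair2 _)).
move=> p1 p1' p2 p2' a1 a2.
have {}a1 : agree (stage t) p1 p1' by move=> k ks; apply: a1; apply: leq_trans stage_le.
have {}a2 : agree (stage t) p2 p2' by move=> k ks; apply: a2; apply: leq_trans stage_le.
rewrite /separation /separation_test /all_pairs /has_pair; congr [&& _, _, _ & _].
- exact: listed_agree.
- by do 2!(apply: eq_all => ?); rewrite /= (listed_agree _ a1).
- by apply: eq_all => ?; do 2!(apply: eq_has => ?); rewrite /= (listed_agree _ a2).
Qed.

Lemma output_reads n t k : reads (output_use k) (output n t k).
Proof.
move=> p1 p1' p2 p2' a1 a2.
rewrite /output /enumeration /open_test /boundary_test /all_pairs /has_pair.
congr (if (if _ then _ && _ else _ && _) then _ else _).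
  by do 2!(apply: eq_all => ?); rewrite /= (listed_agree _ a1).
by do 2!(apply: eq_has => ?); rewrite /= (listed_agree _ a2).
Qed.
End Algorithm.

Section AlgorithmComputable.
Variable k : nat.
Implicit Types (n t B M i j f : seq nat -> nat) (x y h : seq nat -> rat).

Lemma computable_rat_grid B M i : computable k B -> computable k M -> computable k i ->
  computable_rat k (fun v => grid rat (B v) (M v) (i v)).
Proof. by move=> *; rewrite /grid; computability. Qed.

Lemma computable_adjacent i j :
  computable k i -> computable k j -> computable k (fun v => adjacent (i v) (j v)).
Proof. by move=> *; rewrite /adjacent; computability. Qed.

Lemma computable_basic_validb f :
  computable k f -> computable k (fun v => basic_validb (basic_of_code (f v))).
Proof.
by move=> cf; apply: (@computable_basic_case _ (fun b _ => basic_validb b)) => // *;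
   rewrite /=; computability.
Qed.

Lemma computable_avoids_square f x y h : computable k f ->
  computable_rat k x -> computable_rat k y -> computable_rat k h ->
  computable k (fun v => avoids_square (basic_of_code (f v)) (x v) (y v) (h v)).
Proof.
move=> cf *; apply: (@computable_basic_case _ (fun b v => avoids_square b (x v) (y v) (h v)));
  by [|move=> * /=; computability].
Qed.

Lemma computable_contains_square f x y h : computable k f ->
  computable_rat k x -> computable_rat k y -> computable_rat k h ->
  computable k (fun v => contains_square (basic_of_code (f v)) (x v) (y v) (h v)).
Proof.
move=> cf *; apply: (@computable_basic_case _ (fun b v => contains_square b (x v) (y v) (h v)));
  by [|move=> * /=; computability].
Qed.

Lemma computable_label n t i j :
  computable k n -> computable k t -> computable k i -> computable k j ->
  computable k (fun v => label (n v) (t v) (i v) (j v)).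
Proof. by move=> *; rewrite /label /grid_size /labels /box_radius /mesh; computability. Qed.
End AlgorithmComputable.
#[export] Hint Resolve computable_rat_grid computable_adjacent computable_basic_validb
  computable_avoids_square computable_contains_square computable_label : computable.

Lemma computable_listed_exterior k u s B :
  computable k u -> computable k s -> computable k B ->
  computable k (fun v => listed (word_nth (u v)) (s v) (inr (B v)%:R)).
Proof. by move=> *; rewrite /listed; computability. Qed.

Lemma computable_listed_cell k u s B M i j :
  computable k u -> computable k s -> computable k B -> computable k M ->
  computable k i -> computable k j ->
  computable k (fun v => listed (word_nth (u v)) (s v) (cell (B v) (M v) (i v) (j v))).
Proof. by move=> *; rewrite /listed /cell /square; computability. Qed.
#[export] Hint Resolve computable_listed_exterior computable_listed_cell : computable.

Lemma computable_separation k n t u1 u2 :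
  computable k n -> computable k t -> computable k u1 -> computable k u2 ->
  computable k (fun v => separation (n v) (t v) (word_nth (u1 v)) (word_nth (u2 v))).
Proof.
move=> *; rewrite /separation /separation_test /coherent /all_pairs /has_pair /grid_size.
by rewrite /box_radius /mesh /stage; computability.
Qed.

Lemma computable_output k n t i u1 u2 :
  computable k n -> computable k t -> computable k i ->
  computable k u1 -> computable k u2 ->
  computable k (fun v => output (n v) (t v) (i v) (word_nth (u1 v)) (word_nth (u2 v))).
Proof.
move=> *; rewrite /output /enumeration /open_test /boundary_test /all_pairs /has_pair /grid_size.
by rewrite /box_radius /mesh; computability.
Qed.

Lemma computable_output_use k i : computable k i -> computable k (fun v => output_use (i v)).
Proof. by move=> *; rewrite /output_use; computability. Qed.

(** * Correctness of the tests *)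

Lemma listed_sound P p s b : lists_exactly P p -> listed p s b -> P b.
Proof.
move=> [Pp _] /hasP[k _ /eqP pk]; have [|[b' [Pb]]] := Pp k; rewrite pk // => -[].
by move=> /(pcan_inj pickleK) ->.
Qed.

Lemma near_listed P p b : lists_exactly P p -> P b -> \forall s \near \oo, listed p s b.
Proof.
move=> [_ pP] /pP[k pk]; exists k.+1 => // s /= ks.
by apply/hasP; exists k; rewrite ?mem_iota ?pk.
Qed.

Lemma lists_exactly_enumeration (P : basic -> Prop) (test : basic -> nat -> nat -> bool) :
  (forall b g s, test b g s -> P b) -> (forall b, P b -> exists g s, test b g s) ->
  lists_exactly P (enumeration test).
Proof.
move=> sound complete; split=> [k|b Pb]; rewrite /enumeration.
  by case: ifP => [/sound Pb|_]; [right; exists (basic_of_code (unpair1 k))|left].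
have [g [s test_b]] := complete b Pb; have [f fb] := basic_of_code_surj b.
by exists (cpair f (cpair g s)); rewrite !(cpairK1, cpairK2) fb test_b.
Qed.

Section Separates.
Variable R : realType.
Local Notation plane := (R * R)%type.
Local Notation sphere := (one_point_compactification plane).

Record separates (D : set sphere) (n B M : nat) (lab : nat -> nat -> nat) : Prop := Separates {
  separates_radius : (0 < B)%N;
  separates_mesh : (0 < M)%N;
  separates_label_le : forall i j, (lab i j <= n)%N;
  separates_exterior : forall z, in_basic_cl (inr B%:R) z -> D z;
  separates_label0 : forall i j, (i < grid_size B M)%N -> (j < grid_size B M)%N ->
    lab i j = 0%N -> forall z, in_basic_cl (cell B M i j) z -> D z;
  separates_coherent : coherent B M lab;
  separates_boundary : forall l, (l < n)%N -> exists i j,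
    [/\ (i < grid_size B M)%N, (j < grid_size B M)%N, lab i j = l.+1 &
        exists z, in_basic (cell B M i j) z /\ cboundary D z] }.

Lemma eq_separates D n B M lab lab' : separates D n B M lab ->
  (forall i j, (i < grid_size B M)%N -> (j < grid_size B M)%N -> lab' i j = lab i j) ->
  (forall i j, (lab' i j <= n)%N) -> separates D n B M lab'.
Proof.
move=> [B0 M0 _ ext lab0 /coherentP coh bd] eq_lab lab'_le; split=> //.
- by move=> i j iB jB; rewrite eq_lab //; apply: lab0.
- by apply/coherentP => i j i' j' iB jB iB' jB'; rewrite !eq_lab //; apply: coh.
- by move=> l /bd[i [j [iB jB labl bdz]]]; exists i, j; rewrite eq_lab.
Qed.

Section Separation.
Variables (D : set sphere) (n B M : nat) (lab : nat -> nat -> nat) (pD pB : nat -> nat).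
Hypotheses (nameD : open_name D pD) (nameB : closed_name (cboundary D) pB).

Lemma separation_test_sound s : (0 < M)%N -> (forall i j, (lab i j <= n)%N) ->
  separation_test n B M lab s pD pB -> separates D n B M lab.
Proof.
move=> M0 lab_le /and4P[ext /all_pairsP lab0 coh /all_iotaP bd].
have [B0 extD] := listed_sound nameD ext; split=> //.
- by rewrite /= ltr0n in B0.
- move=> i j iB jB labij; have := lab0 i j iB jB; rewrite labij /=.
  by move=> /(listed_sound nameD)[].
- move=> l /bd/has_pairP[i [j [iB jB /andP[/eqP labl /(listed_sound nameB)[_ bdz]]]]].
  by exists i, j.
Qed.

Lemma near_separation_test : separates D n B M lab ->
  \forall s \near \oo, separation_test n B M lab s pD pB.
Proof.
move=> [B0 M0 _ extD lab0 coh bd]; rewrite /separation_test.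
have near_ext : \forall s \near \oo, listed pD s (inr B%:R).
  by apply: near_listed nameD _; split; rewrite //= ltr0n.
have near_lab0 : \forall s \near \oo, all_pairs (grid_size B M) (fun i j =>
    (lab i j != 0%N) || listed pD s (cell B M i j)).
  apply: filter_all_pairs => i j iB jB; have [labij|_] := eqVneq (lab i j) 0%N; last by near=> s.
  apply: near_listed nameD _; split; [exact: cell_valid|exact: lab0].
have near_bd : \forall s \near \oo, forall l, (l < n)%N -> has_pair (grid_size B M)
    (fun i j => (lab i j == l.+1) && listed pB s (cell B M i j)).
  apply: filter_forall_ltn => l /bd[i [j [iB jB labl bdz]]].
  have : \forall s \near \oo, listed pB s (cell B M i j).
    by apply: near_listed nameB _; split; [exact: cell_valid|].
  by apply: filterS => s ls; apply/has_pairP; exists i, j; rewrite labl eqxx.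
apply: filterS3 near_ext near_lab0 near_bd => s ext l0 /all_iotaP bds.
exact/and4P.
Unshelve. all: by end_near. Qed.
End Separation.

Section Existence.
Variables (D : set sphere) (n : nat) (C : 'I_n -> set sphere).
Hypotheses (openD : open D) (Dinf : D None) (labC : component_labeling (ccompl D) C).

Lemma cell_labelling_exists B M : exists lab : nat -> nat -> option 'I_n, forall i j,
  if lab i j is Some l then exists2 p, in_basic_cl (cell B M i j) (Some p) & C l (Some p)
  else forall z, in_basic_cl (cell B M i j) z -> D z.
Proof.
suff /choice[lab labP] ij : exists o : option 'I_n,
    if o is Some l then exists2 p, in_basic_cl (cell B M ij.1 ij.2) (Some p) & C l (Some p)
    else forall z, in_basic_cl (cell B M ij.1 ij.2) z -> D z.
  by exists (fun i j => lab (i, j)) => i j; apply: (labP (i, j)).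
have [sub|] := pselect (forall z, in_basic_cl (cell B M ij.1 ij.2) z -> D z).
  by exists None.
move=> /existsNP[z /not_implyP[cellz Dz]]; have [l Cz] := labeling_cover labC Dz.
by have [p zE] := compl_finite Dinf Dz; exists (Some l), p; rewrite -zE.
Qed.

Lemma separates_exists : exists B M lab, separates D n B M lab.
Proof.
have [B B0 extD] := exterior_sub_domain openD Dinf.
have [N /=] := filter_ex (near_right0_div_natr (ltr0n R 5) (ltn0Sn 0)
  (labeling_distance openD labC Dinf)).
rewrite mul1n => distC; have N0 : (0 < N.+1)%N by [].
have [lab labP] := cell_labelling_exists B N.+1.
have label_near i j i' j' l l' p : adjacent i i' -> adjacent j j' -> lab i' j' = Some l' ->
    in_basic_cl (cell B N.+1 i j) (Some p) -> C l (Some p) -> l = l'.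
  move=> ii' jj' labl' cellp Cp; have := labP i' j'; rewrite labl' => -[q cellq Cq].
  exact: distC Cp Cq (adjacent_cells_ball N0 ii' jj' cellp cellq).
exists B, N.+1, (fun i j => if lab i j is Some l then l.+1 else 0%N); split=> //.
- by move=> i j; case: (lab i j).
- by move=> i j _ _; have := labP i j; case: (lab i j).
- apply/coherentP => i j i' j' _ _ _ _ ii' jj'; have := labP i j.
  case: (lab i j) => [l [p cellp Cp]|] //; case labl': (lab i' j') => [l'|] // _ _.
  by rewrite (label_near _ _ _ _ _ _ _ ii' jj' labl' cellp Cp).
- move=> l ln; have [p [Cp clDp]] := labeling_meets_closure openD labC Dinf (Ordinal ln).
  have [pB1 pB2] := compl_sub_box extD (labeling_sub labC Cp).
  have [i [j [iB jB cellp]]] := cell_cover N0 pB1 pB2; exists i, j; split=> //.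
    have cellp_cl := in_basic_sub_cl cellp; case labl': (lab i j) => [l'|].
      by rewrite -(label_near i j i j (Ordinal ln) l' p) // /adjacent leqnSn.
    by case: (labeling_sub labC Cp); have := labP i j; rewrite labl'; apply.
  exists (Some p); split=> //; rewrite cboundary_open //; split=> //.
  exact: labeling_sub Cp.
Qed.
End Existence.
End Separates.

Section Regions.
Variable R : realType.
Local Notation plane := (R * R)%type.
Local Notation sphere := (one_point_compactification plane).
Variables (D : set sphere) (n B M : nat) (lab : nat -> nat -> nat).
Hypotheses (openD : open D) (Dinf : D None) (sepD : separates D n B M lab).

Let M_gt0 : (0 < M)%N. Proof. exact: separates_mesh sepD. Qed.
Let Mg_gt0 g : (0 < M * g.+1)%N. Proof. by rewrite muln_gt0 M_gt0. Qed.

Definition region (l : nat) : set sphere := fun z => exists i j,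
  [/\ (i < grid_size B M)%N, (j < grid_size B M)%N, lab i j = l.+1 & in_basic (cell B M i j) z].

Lemma open_region l : open (region l).
Proof.
rewrite openE => z [i [j [iB jB labl cellz]]].
have : nbhs z (in_basic (cell B M i j)).
  by apply: open_nbhs_nbhs; split; [exact: open_in_basic|].
by apply: filterS => w cellw; exists i, j.
Qed.

Lemma region_label i j l z : (i < grid_size B M)%N -> (j < grid_size B M)%N ->
  in_basic (cell B M i j) z -> lab i j != 0%N -> region l z -> lab i j = l.+1.
Proof.
move=> iB jB cellz l0 [i' [j' [iB' jB' labl cellz']]].
have [ii' jj'] := cell_adjacent M_gt0 cellz cellz'.
have /coherentP coh := separates_coherent sepD.
by rewrite (coh i j i' j') // labl.
Qed.

Lemma region_inj l l' z : region l z -> region l' z -> l = l'.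
Proof.
move=> [i [j [iB jB labl cellz]]] /(region_label iB jB cellz).
by rewrite labl => /(_ isT)[].
Qed.

Lemma label_neq0 i j z : (i < grid_size B M)%N -> (j < grid_size B M)%N ->
  in_basic (cell B M i j) z -> ~ D z -> lab i j != 0%N.
Proof.
move=> iB jB /in_basic_sub_cl cellz Dz; apply/eqP => lab0; apply: Dz.
exact: (separates_label0 sepD iB jB lab0 cellz).
Qed.

Lemma compl_cell_cover g z : ~ D z -> exists i j,
  [/\ (i < grid_size B (M * g.+1))%N, (j < grid_size B (M * g.+1))%N &
      in_basic (cell B (M * g.+1) i j) z].
Proof.
move=> Dz; have [p zE] := compl_finite Dinf Dz; rewrite {}zE in Dz *.
by have [pB1 pB2] := compl_sub_box (separates_exterior sepD) Dz; apply: cell_cover.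
Qed.

Lemma refined_label g i j l z :
  (i < grid_size B (M * g.+1))%N -> (j < grid_size B (M * g.+1))%N ->
  in_basic (cell B (M * g.+1) i j) z -> ~ D z -> region l z ->
  lab (i %/ g.+1) (j %/ g.+1) = l.+1.
Proof.
move=> /refined_index_lt iB /refined_index_lt jB /(cell_refine M_gt0) cellz Dz.
exact: region_label iB jB cellz (label_neq0 iB jB cellz Dz).
Qed.

Lemma region_refine g i j l z :
  (i < grid_size B (M * g.+1))%N -> (j < grid_size B (M * g.+1))%N ->
  in_basic (cell B (M * g.+1) i j) z -> lab (i %/ g.+1) (j %/ g.+1) = l.+1 -> region l z.
Proof.
move=> /refined_index_lt iB /refined_index_lt jB /(cell_refine M_gt0) cellz labl.
by exists (i %/ g.+1)%N, (j %/ g.+1)%N.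
Qed.

Lemma region_cover z : ~ D z -> exists l : 'I_n, region l z.
Proof.
move=> Dz; have [i [j [iB jB cellz]]] := compl_cell_cover 0 Dz.
have := label_neq0 (refined_index_lt iB) (refined_index_lt jB) (cell_refine M_gt0 cellz) Dz.
case labl : (lab _ _) => [//|l] _.
have ln : (l < n)%N by rewrite -labl; exact: separates_label_le sepD _ _.
by exists (Ordinal ln); apply: region_refine iB jB cellz labl.
Qed.

Lemma region_components (C : 'I_n -> set sphere) : component_labeling (ccompl D) C ->
  exists2 psi : 'I_n -> 'I_n, bijective psi & forall l, C (psi l) = region l `&` ~` D.
Proof.
move=> labC; have bigC := labeling_bigcup labC.
have [| | | | | |psi bij psiE] := @open_partition_reindex _ _ C (fun l => region l).
- exact: labeling_neq0 labC.
- exact: labeling_connected labC.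
- by move=> l; apply: open_region.
- by move=> l l' _ _ [z [rz rz']]; apply/ord_inj/(region_inj rz).
- by rewrite bigC => z /region_cover[l rz]; exists l.
- move=> l; rewrite bigC.
  have [i [j [iB jB labl [z [cellz bdz]]]]] := separates_boundary sepD (ltn_ord l).
  by exists z; move: bdz; rewrite cboundary_open // => -[_ Dz]; split=> //; exists i, j.
by exists psi => // l; rewrite psiE bigC.
Qed.

Variables (l : nat) (pD pB : nat -> nat).
Hypotheses (nameD : open_name D pD) (nameB : closed_name (cboundary D) pB).

Lemma open_test_sound b g s z : open_test B M lab l b g s pD ->
  in_basic_cl b z -> ~ (region l `&` ~` D) z.
Proof.
move=> /andP[_ /all_pairsP test] bz [rz Dz].
have [i [j [iB jB cellz]]] := compl_cell_cover g Dz.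
have := test i j iB jB; rewrite (refined_label iB jB cellz Dz rz) eqxx /=.
move=> /orP[avoid|/(listed_sound nameD)[_ subD]].
  exact: avoids_square_sound avoid cellz bz.
by apply: Dz; apply: subD; apply: in_basic_sub_cl.
Qed.

Lemma near_box_trichotomy b : (forall z, in_basic_cl b z -> ~ (region l `&` ~` D) z) ->
  \forall e \near 0^'+, forall p, box B p ->
    [\/ ball p e `<=` [set q | ~ in_basic_cl b (Some q)],
        ball p e `<=` Some @^-1` D | ball p e `<=` [set q | ~ region l (Some q)]].
Proof.
move=> disj.
have near_some (U : set sphere) (q : plane) : open U -> U (Some q) ->
    \forall p \near q & e \near 0^'+, ball p e `<=` Some @^-1` U.
  move=> openU Uq; apply: near_ball_sub; apply: open_nbhs_nbhs; split=> //.
  exact: open_preimage_some.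
have /compact_near_coveringP covB := @compact_box R B.
apply: (covB _ _ (fun e p => [\/ _, _ | _])) => q _.
have [bq|nbq] := pselect (in_basic_cl b (Some q)); last first.
  have : nbhs q (~` [set p | in_basic_cl b (Some p)]).
    by apply: open_nbhs_nbhs; split=> //; apply: closed_openC; apply: closed_in_basic_cl.
  by move=> /near_ball_sub; apply: filterS => -[p e] pe; apply: Or31.
have [Dq|Dq] := pselect (D (Some q)).
  by apply: filterS (near_some _ _ openD Dq) => -[p e] pe; apply: Or32.
have [l' rq] := region_cover Dq.
apply: filterS (near_some _ _ (@open_region l') rq) => -[p e] pe; apply: Or33 => w /pe rw rw'.
by apply: disj bq _; split=> //; rewrite -(region_inj rw rw').
Qed.

Lemma open_test_complete b : basic_valid b ->
  (forall z, in_basic_cl b z -> ~ (region l `&` ~` D) z) ->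
  exists g s, open_test B M lab l b g s pD.
Proof.
move=> vb disj; have [g /= small] :=
  filter_ex (near_right0_div_natr (ltr0n R 2) M_gt0 (near_box_trichotomy disj)).
suff /filter_ex[s test] : \forall s \near \oo, open_test B M lab l b g s pD by exists g, s.
rewrite /open_test; move/basic_validP: (vb) => -> /=.
apply: filter_all_pairs => i j iB jB; set p := cell_center R B (M * g.+1) i j.
have boxp : box B p by split; apply: grid_box.
have [avoid|inD|out_region] := small p boxp.
- near=> s; rewrite (@avoids_square_complete R) ?orbT // => z cellz bz.
  by case: z cellz bz => [q|//] /(in_cell_cl_ball (Mg_gt0 g)) /avoid.
- have : \forall s \near \oo, listed pD s (cell B (M * g.+1) i j).
    apply: near_listed nameD _; split=> [|[q|//]]; first exact: cell_valid.
    by move=> /(in_cell_cl_ball (Mg_gt0 g))/inD.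
  by apply: filterS => s ->; rewrite !orbT.
- near=> s; apply/orP; left; apply/eqP => labl.
  apply: (out_region p); first by apply: ballxx; rewrite divr_gt0 ?ltr0n.
  exact: region_refine iB jB (in_cell_center R B (Mg_gt0 g) i j) labl.
Unshelve. all: by end_near. Qed.

Lemma boundary_test_sound b g s : boundary_test B M lab l b g s pB ->
  exists z, in_basic b z /\ (region l `&` cboundary D) z.
Proof.
move=> /andP[_ /has_pairP[i [j [iB jB /and3P[/eqP labl inb /(listed_sound nameB)]]]]].
move=> [_ [z [cellz bdz]]]; exists z; split; first exact: contains_square_sound inb cellz.
by split=> //; apply: region_refine iB jB cellz labl.
Qed.

Lemma boundary_test_complete b z : basic_valid b -> in_basic b z ->
  (region l `&` cboundary D) z -> exists g s, boundary_test B M lab l b g s pB.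
Proof.
move=> vb bz [rz bdz]; have Dz : ~ D z by move: bdz; rewrite cboundary_open // => -[].
have [p zE] := compl_finite Dinf Dz; rewrite {}zE in bz rz bdz Dz.
have openb := open_preimage_some (@open_in_basic R b).
have [g /= small] := filter_ex (near_right0_div_natr (ltr0n R 5) M_gt0 (open_subball openb bz)).
have [i [j [iB jB cellp]]] := compl_cell_cover g Dz.
have [s ls] := filter_ex (near_listed nameB (conj (cell_valid B i j (Mg_gt0 g))
  (ex_intro _ _ (conj cellp bdz)))).
exists g, s; rewrite /boundary_test; move/basic_validP: (vb) => -> /=.
apply/has_pairP; exists i, j; split=> //.
rewrite (refined_label iB jB cellp Dz rz) eqxx ls andbT /=.
apply: (@contains_square_complete R) => [|[q|//] cellq]; first by rewrite invr_ge0.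
apply: small; apply: (adjacent_cells_ball (Mg_gt0 g) _ _ (in_basic_sub_cl cellp) cellq).
  by rewrite /adjacent leqnSn.
by rewrite /adjacent leqnSn.
Qed.
End Regions.

Lemma component_labeling_reindex (R : realType) (S : cset R) (n : nat) (C : 'I_n -> cset R)
    (psi : 'I_n -> 'I_n) :
  bijective psi -> component_labeling S C -> component_labeling S (C \o psi).
Proof.
move=> [phi psiK phiK] [isC [inj surj]]; split; first by move=> l; apply: isC.
split=> [l l' /inj/(can_inj psiK)//|K /surj[c Kc]].
by exists (phi c) => z; rewrite /= phiK.
Qed.

Section Output.
Variables (R : realType) (D : cset R) (n : nat) (C : 'I_n -> cset R) (pD pB : nat -> nat).
Hypotheses (openD : copen D) (Dinf : D None) (labC : component_labeling (ccompl D) C).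
Hypotheses (nameD : open_name D pD) (nameB : closed_name (cboundary D) pB).

Lemma separation_exists : exists t, separation n t pD pB.
Proof.
have [B [M [lab sepD]]] := separates_exists ((copenP D).1 openD) Dinf labC.
have M_gt0 := separates_mesh sepD; set W := grid_size B M in sepD.
pose u := code_word (Defs.prefix (fun k => lab (k %/ W) (k %% W))%N (W * W)).
pose t s := cpair B (cpair M.-1 (cpair u s)).
have B_t s : box_radius (t s) = B by rewrite /box_radius cpairK1.
have M_t s : mesh (t s) = M by rewrite /mesh cpairK2 cpairK1 prednK.
have label_t s : label n (t s) = (fun i j => word_nth u (i * W + j) %% n.+1)%N.
  by rewrite /label B_t M_t /labels !(cpairK1, cpairK2).
have sep_u : separates D n B M (fun i j => word_nth u (i * W + j) %% n.+1)%N.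
  apply: (eq_separates sepD) => [i j iW jW|i j]; last by rewrite -ltnS ltn_pmod.
  rewrite word_nth_prefix; last by nia.
  rewrite divnMDl // divn_small // addn0 modnMDl !modn_small // ltnS.
  exact: separates_label_le sepD _ _.
have [s sep_s] := filter_ex (near_separation_test nameD nameB sep_u).
by exists (t s); rewrite /separation B_t M_t label_t /stage !cpairK2.
Qed.

Variable t : nat.
Hypothesis sep : separation n t pD pB.

Lemma separation_sound : separates D n (box_radius t) (mesh t) (label n t).
Proof.
by apply: (separation_test_sound nameD nameB _ _ sep) => // i j; rewrite -ltnS ltn_pmod.
Qed.

Lemma substream_output_even l : substream (fun k => output n t k pD pB) (2 * l) =
  enumeration (fun b g s => open_test (box_radius t) (mesh t) (label n t) l b g s pD).
Proof.
by apply/funext => j; rewrite /substream /output cpairK1 cpairK2 modnMr eqxx mulKn.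
Qed.

Lemma substream_output_odd l : substream (fun k => output n t k pD pB) (2 * l).+1 =
  enumeration (fun b g s => boundary_test (box_radius t) (mesh t) (label n t) l b g s pB).
Proof.
apply/funext => j; rewrite /substream /output cpairK1 cpairK2 modn2 /= mul2n odd_double.
by rewrite divn2 /= uphalf_double.
Qed.

Lemma output_valid : valid_output D n (fun k => output n t k pD pB).
Proof.
have oD := (copenP D).1 openD; have sepD := separation_sound.
have [psi bij psiE] := region_components oD Dinf sepD labC.
exists (C \o psi); split; first exact: component_labeling_reindex.
move=> l; rewrite /= substream_output_even substream_output_odd; split.
  apply: lists_exactly_enumeration => [b g s test|b [vb disj]].
    split; first by case/andP: test => /basic_validP.
    by move=> z bz; rewrite /ccompl psiE; exact: (open_test_sound Dinf sepD nameD test bz).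
  rewrite /ccompl psiE in disj; exact: (open_test_complete oD Dinf sepD nameD vb disj).
have bdE : cboundary (C (psi l)) = region (box_radius t) (mesh t) (label n t) l `&` cboundary D.
  rewrite (cboundary_labeling oD labC) psiE (cboundary_open oD) -setIA.
  by rewrite [~` D `&` _]setIC.
rewrite /closed_name bdE; apply: lists_exactly_enumeration.
  move=> b g s test; split; first by case/andP: test => /basic_validP.
  exact: (boundary_test_sound sepD nameB test).
move=> b [vb [z [bz bdz]]].
exact: (boundary_test_complete oD Dinf sepD nameB vb bz bdz).
Qed.
End Output.

Theorem theorem3p2 :
  forall R : realType,
  exists M : rf,
    rf_total4 M /\
    forall (D : cset R) (n : nat),
      cdomain D -> D None -> ~ D (Some (0%R : R, 0%R : R)) ->
      (exists C : 'I_n -> cset R, component_labeling (ccompl D) C) ->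
      forall pD pB : nat -> nat,
        open_name D pD -> closed_name (cboundary D) pB ->
        exists q : nat -> nat,
          machine_computes M n pD pB q /\ valid_output D n q.
Proof.
move=> R.
have [M [totalM computesM]] := search_machine separation_reads output_reads
  computable_separation computable_output computable_output_use.
exists M; split=> // D n [openD _] Dinf _ [C labC] pD pB nameD nameB.
have [t sep_t Mt] := computesM n pD pB (separation_exists openD Dinf labC nameD nameB).
exists (fun k => output n t k pD pB); split=> //.
exact: (output_valid openD Dinf labC nameD nameB sep_t).
Qed.
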